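(* Let $c \geq 2$ be a fixed integer. Then there exist a constant $L = L(c) > 0$, depending only on $c$, and an integer $n_0 = n_0(c)$ such that for all $n \geq n_0$, $$X_{\leq (c-2)}^{(c)}(n) \geq L n^{\frac{4}{3}}.$$
   Context: A finite set of points in $\mathbb{R}^2$ is in general position if no three of its points lie on a line. A $c$-colored point set is a finite set $P \subset \mathbb{R}^2$ together with an arbitrary assignment of a color from $\{1,2,\ldots,c\}$ to each point of $P$. A triangle determined by $P$ is a triangle whose three vertices are points of $P$; it is monochromatic if its three vertices have the same color. For a finite $c$-colored point set $P \subset \mathbb{R}^2$ in general position and an integer $s \geq 0$, $X_{\leq s}^{(c)}(P)$ denotes the number of monochromatic triangles determined by $P$ that contain at most $s$ points of $P$ (of any color) in their interior. Define $$X_{\leq s}^{(c)}(n) := \min_{P} X_{\leq s}^{(c)}(P),$$ where the minimum is over all $c$-colored point sets $P \subset \mathbb{R}^2$ in general position with $|P| = n$. *)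

(* Defs.v *)
From mathcomp Require Import all_boot all_order all_algebra finmap.
From mathcomp Require Import ring.
From mathcomp Require Import boolp classical_sets reals topology normedtype exp.

Set Implicit Arguments.
Unset Strict Implicit.
Unset Printing Implicit Defensive.

Import Order.TTheory GRing.Theory Num.Theory.
Import numFieldNormedType.Exports.

Local Open Scope classical_set_scope.
Local Open Scope ring_scope.

Section ColoredPointSets.
Variable R : realType.

Notation plane := ('rV[R]_2).

Definition is_line (l : set plane) : Prop :=
  exists a v : plane, v != 0 /\ l = [set a + t *: v | t in [set: R]].

Definition general_position (P : {fset plane}) : Prop :=
  forall a b c : plane, a \in P -> b \in P -> c \in P ->
    a != b -> a != c -> b != c ->
    ~ exists l, [/\ is_line l, l a, l b & l c].

(* The closed convex polygon spanned by T. *)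
Definition hull (P : {fset plane}) (T : {set P}) : set plane :=
  [set p | exists w : P -> R,
    [/\ forall i, i \in T -> 0 <= w i,
        \sum_(i in T) w i = 1
      & p = \sum_(i in T) w i *: val i]].

(* All points of P count here, whatever their color. *)
Definition interior_points (P : {fset plane}) (T : {set P}) : {set P} :=
  [set p : P | `[< (hull T)° (val p) >]]%SET.

Definition monochromatic (c : nat) (P : {fset plane}) (chi : P -> 'I_c)
    (T : {set P}) : bool :=
  [forall i in T, forall j in T, chi i == chi j].

(* A triangle is identified with its set of three vertices; the vertices of
   such a set are affinely independent when P is in general position. *)
Definition X_le (c s : nat) (P : {fset plane}) (chi : P -> 'I_c) : nat :=
  #|[set T : {set P} | [&& #|T| == 3, monochromatic chi T
                         & (#|interior_points T| <= s)%N]]%SET|.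

Definition X_values (c s n : nat) : set nat :=
  [set m | exists (P : {fset plane}) (chi : P -> 'I_c),
    [/\ general_position P, #|` P| = n & X_le s chi = m]].

(* The least element of [X_values c s n]; the default value 0 is only used
   when this set is empty, which X_minP excludes for c > 0. *)
Definition X_min (c s n : nat) : nat :=
  xget 0%N [set m | X_values c s n m /\
                    forall m', X_values c s n m' -> (m <= m')%N].

Let parab (i : nat) : plane := \row_j i%:R ^+ j.+1.

Let parab_inj : injective parab.
Proof.
move=> i j /rowP /(_ ord0); rewrite !mxE !expr1 => /eqP.
by rewrite eqr_nat => /eqP.
Qed.

Lemma general_position_exists (n : nat) :
  exists P : {fset plane}, general_position P /\ #|` P| = n.
Proof.
exists [fset parab (val i) | i in 'I_n]%fset; split; last first.
  rewrite card_imfset /=; last by move=> i j /parab_inj /val_inj.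
  by rewrite size_enum_ord.
move=> _ _ _ /imfsetP[/= i _ ->] /imfsetP[/= j _ ->] /imfsetP[/= k _ ->].
rewrite !(inj_eq parab_inj) => ij ik jk.
case=> _ [[a [v [v0 ->]]] [ti _ Ei] [tj _ Ej] [tk _ Ek]].
have E0 (l : nat) (t : R) : a + t *: v = parab l ->
    l%:R = a 0 ord0 + t * v 0 ord0 /\ l%:R ^+ 2 = a 0 ord_max + t * v 0 ord_max.
  by move/rowP => E; move: (E ord0) (E ord_max); rewrite !mxE !expr1 => -> ->.
have [xi yi] := E0 _ _ Ei; have [xj yj] := E0 _ _ Ej.
have [xk yk] := E0 _ _ Ek.
have : (j%:R - i%:R) * (k%:R - i%:R) * (k%:R - j%:R) == 0 :> R.
  have -> : (j%:R - i%:R) * (k%:R - i%:R) * (k%:R - j%:R) =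
    (j%:R - i%:R) * (k%:R ^+ 2 - i%:R ^+ 2)
    - (k%:R - i%:R) * (j%:R ^+ 2 - i%:R ^+ 2) :> R by ring.
  by rewrite yi yj yk xi xj xk; apply/eqP; ring.
by rewrite !mulf_eq0 !subr_eq0 !eqr_nat !(eq_sym (val k)) (eq_sym (val j))
  (negPf ij) (negPf ik) (negPf jk).
Qed.

Lemma X_minP (c s n : nat) : (0 < c)%N ->
  X_values c s n (X_min c s n) /\
  forall m, X_values c s n m -> (X_min c s n <= m)%N.
Proof.
move=> c0; rewrite /X_min; case: xgetP => [_ -> //|nomin]; exfalso.
have ex : exists m, `[< X_values c s n m >].
  have [P [gP cP]] := general_position_exists n.
  exists (X_le s (fun _ : P => Ordinal c0)).
  by apply/asboolP; exists P, (fun=> Ordinal c0).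
case: (ex_minnP ex) => m /asboolP Xm mmin; apply: (nomin m); split=> // m' ?.
by apply: mmin; apply/asboolP.
Qed.

End ColoredPointSets.

(* Main.v *)
(* Following Pach and Toth.  Fix a colour and weigh its points by c - 1 and all
   other points by -1, so that the weight of a set measures the excess of the
   colour.  Disjoint triangles with vertices of that colour and none of its
   points inside are bad only if they use up c - 1 points of other colours; hence
   fanning out from a point p of a convex set of weight w produces about
   w / (c - 1) good triangles at p, and a convex set of linear size and weight
   at least k ~ n^(1/3) already gives of order n k good triangles.

   Otherwise all large convex sets are balanced.  Removing extreme points of one
   colour keeps a set convex and unbalances it, so the hull of that colour class
   has O(k) vertices, and one triangle a v v' of a fan triangulation of the hull
   contains of order k^2 points.  Among its interior points of the colour there
   is a chain of order k nested triangles on a common side, and such a chain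
   yields a triangulation with that many triangles at a, v, v' in excess of the
   number of interior points.  As the triangle is balanced too, at least k of
   them are good.  Now delete a, v, v' and repeat, of order n times. *)
Require Import Defs.
From mathcomp Require Import all_boot all_order all_algebra.
From mathcomp Require Import boolp reals exp zify ring lra.

Set Implicit Arguments.
Unset Strict Implicit.
Unset Printing Implicit Defensive.

Import Order.TTheory GRing.Theory Num.Theory.
Local Open Scope ring_scope.

(** * Finite combinatorics and arithmetic of the constants *)

Lemma chain_or_antichain (T : finType) (r : rel T) (s u : nat) (A : {set T}) :
  (s * u < #|A|)%N ->
  (exists l : seq T, [/\ sorted r l, {subset l <= A} & size l = s.+1]) \/
  exists B : {set T}, [/\ B \subset A, (u < #|B|)%N
    & {in B &, forall x y, ~~ r x y}].
Proof.
elim: s A => [|s IH] A ltA.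
  have /card_gt0P[x xA] := ltA; left; exists [:: x]; split=> // y.
  by rewrite inE => /eqP->.
(* The minimal elements of [A] are pairwise unrelated. If there are at most [u] of them, a chain
   found in the rest starts at a non-minimal point and can be extended downwards. *)
pose M := [set x in A | [forall y in A, ~~ r y x]].
case: (ltnP u #|M|) => [uM|Mu].
  right; exists M; split=> //; first by apply/subsetP => x; rewrite inE => /andP[].
  move=> x y; rewrite !inE => /andP[xA _] /andP[_ /forall_inP/(_ _ xA)].
  by [].
have sM : M \subset A by apply/subsetP => x; rewrite inE => /andP[].
have lt' : (s * u < #|A :\: M|)%N.
  by rewrite cardsD (setIidPr sM); lia.
case: (IH _ lt') => [[[|x l] [sl lA //= [sz]]]|[B [BA uB Bu]]]; last first.
  by right; exists B; split=> //; apply: subset_trans BA (subsetDl _ _).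
have := lA x; rewrite !inE eqxx => /(_ isT) /andP[+ xA].
rewrite xA /= negb_forall_in => /exists_inP[y yA]; rewrite negbK => ryx.
left; exists [:: y, x & l]; split; rewrite /= ?sz //; first by rewrite ryx.
move=> z; rewrite inE => /predU1P[->//|/lA]; by rewrite inE => /andP[].
Qed.

Lemma pigeonhole_fiber (T : finType) (A N : {set T}) (f : T -> T) :
  (0 < #|A|)%N -> {in A, forall x, f x \in N} ->
  exists2 v, v \in N & (#|A| <= #|[set x in A | f x == v]| * #|N|)%N.
Proof.
case/card_gt0P => x0 x0A fN.
have [v vN vmax] := @arg_maxnP T (f x0) (mem N) (fun v => #|[set x in A | f x == v]|)
  (fN _ x0A).
exists v => //; rewrite -sum1_card (partition_big f (mem N)) //= mulnC -sum_nat_const.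
apply: leq_sum => u uN; apply: leq_trans (vmax _ uN).
by rewrite -sum1_card leq_eqVlt; apply/orP; left; apply/eqP;
   apply: eq_bigl => x; rewrite inE.
Qed.

Lemma exists_subset_card (T : finType) (A : {set T}) m : (m <= #|A|)%N ->
  exists2 B : {set T}, B \subset A & #|B| = m.
Proof.
move=> le; exists [set x in take m (enum A)].
  by apply/subsetP => x; rewrite inE => /mem_take; rewrite mem_enum.
by rewrite cardsE (card_uniqP _) ?take_uniq ?enum_uniq // size_takel // -cardE.
Qed.

(** Here [h] counts hull vertices and [m] the points in the richest fan triangle. If the conclusion
    failed, [n] would be at most ck + 6(ck)^2 + 64 c^4 k^3, and 71 = 1 + 6 + 64. *)
Lemma fan_triangle_size (c k N0 h m n : nat) : (0 < c)%N -> (0 < k)%N ->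
  (h <= c * k)%N -> (n <= h + m * h)%N -> (71 * c ^ 4 * k ^ 3 <= N0)%N ->
  (2 * N0 < n)%N -> (6 * c * k + c * (8 * c * k * (8 * c * k)) < m)%N.
Proof.
move=> c0 k0 hc nh N nN; rewrite ltnNge; apply/negP => le.
have : (n <= c * k * (1 + (6 * c * k + c * (8 * c * k * (8 * c * k)))))%N.
  by apply: (leq_trans nh); rewrite -{1}[h]mul1n -mulnDl mulnC leq_mul // leq_add2l.
have e1 : (c * k <= c ^ 4 * k ^ 3)%N.
  by rewrite leq_mul // ?(leq_pexp2l _ (_ : 1 <= _)%N) // -{1}[c]expn1 leq_pexp2l.
have e2 : (c ^ 2 * k ^ 2 <= c ^ 4 * k ^ 3)%N by rewrite leq_mul // leq_pexp2l.
have -> : (c * k * (1 + (6 * c * k + c * (8 * c * k * (8 * c * k))))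
  = c * k + 6 * (c ^ 2 * k ^ 2) + 64 * (c ^ 4 * k ^ 3))%N by ring.
rewrite -mulnA in N; move: e1 e2 N nN.
by move: (c * k)%N (c ^ 2 * k ^ 2)%N (c ^ 4 * k ^ 3)%N => x y z; clear; lia.
Qed.

Lemma cube_root_nat (C n : nat) : (0 < C)%N ->
  exists k, (C * k ^ 3 <= n < C * k.+1 ^ 3)%N.
Proof.
move=> C0; have ex : exists k, (C * k ^ 3 <= n)%N by exists 0%N; rewrite muln0.
have ub k : (C * k ^ 3 <= n)%N -> (k <= n)%N.
  apply: leq_trans; apply: leq_trans (leq_pmull _ C0).
  by case: k => // k; rewrite -[X in (X <= _)%N]expn1 leq_pexp2l.
case: (ex_maxnP ex ub) => k kn kmax; exists k; rewrite kn ltnNge.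
by apply/negP => /kmax; rewrite ltnn.
Qed.

(** * Counting good triples *)

Section Goods.
Variables (T : finType) (good : pred {set T}).

(** The set [Z] localises the count to triples with a vertex in it, so that counts from different
    vertices or different stages can be combined. *)
Definition goods (V Z : {set T}) :=
  [set t : {set T} | [&& good t, #|t| == 3%N, t \subset V & ~~ [disjoint t & Z]]].

Lemma goodsS (V V' Z Z' : {set T}) : V \subset V' -> Z \subset Z' ->
  goods V Z \subset goods V' Z'.
Proof.
move=> sV sZ; apply/subsetP => t; rewrite !inE => /and4P[-> -> tV tZ] /=.
rewrite (subset_trans tV sV) /=; apply: contra tZ; exact: disjointWr.
Qed.

Lemma card3 (a b d : T) : a != b -> b != d -> a != d -> #|[set a; b; d]| = 3%N.
Proof. by move=> ab bd ad; rewrite -setUA cardsU1 cards2 bd !inE negb_or ab ad. Qed.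

(** Three points do not fit into an intersection of size two. This makes the counts over the pieces
    of a subdivided triangle additive. *)
Lemma goods_disj (V1 V2 Z1 Z2 : {set T}) : (#|V1 :&: V2| <= 2)%N ->
  [disjoint goods V1 Z1 & goods V2 Z2].
Proof.
move=> le2; apply/pred0P => t /=; apply/negP; rewrite !inE.
case/andP=> /and4P[_ /eqP t3 s1 _] /and4P[_ _ s2 _].
have : t \subset V1 :&: V2 by rewrite subsetI s1 s2.
by move/subset_leq_card; lia.
Qed.

Lemma card_goods2 (V V1 V2 Z Z1 Z2 : {set T}) : V1 \subset V -> V2 \subset V ->
  Z1 \subset Z -> Z2 \subset Z -> (#|V1 :&: V2| <= 2)%N ->
  (#|goods V1 Z1| + #|goods V2 Z2| <= #|goods V Z|)%N.
Proof.
move=> ? ? ? ? le2; have := goods_disj Z1 Z2 le2.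
rewrite -leq_card_setU => /eqP<-; apply: subset_leq_card.
by rewrite subUset !goodsS.
Qed.

Lemma card_goods3 (V V1 V2 V3 Z Z1 Z2 Z3 : {set T}) :
  V1 \subset V -> V2 \subset V -> V3 \subset V ->
  Z1 \subset Z -> Z2 \subset Z -> Z3 \subset Z ->
  (#|V1 :&: V2| <= 2)%N -> (#|V1 :&: V3| <= 2)%N -> (#|V2 :&: V3| <= 2)%N ->
  (#|goods V1 Z1| + #|goods V2 Z2| + #|goods V3 Z3| <= #|goods V Z|)%N.
Proof.
move=> ? ? ? ? ? ? l12 l13 l23; have := goods_disj Z1 Z2 l12.
rewrite -leq_card_setU => /eqP<-.
have : [disjoint goods V1 Z1 :|: goods V2 Z2 & goods V3 Z3].
  by rewrite -setI_eq0 setIUl !disjoint_setI0 ?setU0 ?goods_disj.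
rewrite -leq_card_setU => /eqP<-; apply: subset_leq_card.
by rewrite !subUset !goodsS.
Qed.

End Goods.

(** * Orientations and triangles *)

Section PlanarSets.
Variables (R : realFieldType) (T : finType) (X Y : T -> R).

(** Twice the signed area of the triangle, positive for a counterclockwise one. *)
Definition orient a b d :=
  (X b - X a) * (Y d - Y a) - (X d - X a) * (Y b - Y a).

(** Strict interior; the factor [orient a b d] makes the test independent of the orientation and
    false for a degenerate triangle. *)
Definition tri a b d x :=
  [&& 0 < orient a b d * orient a b x, 0 < orient a b d * orient b d x
    & 0 < orient a b d * orient d a x].

Lemma orient_rot a b d : orient a b d = orient b d a.
Proof. by rewrite /orient; ring. Qed.

Lemma orient_swap a b d : orient a b d = - orient b a d.
Proof. by rewrite /orient; ring. Qed.

Lemma orientaab a b : orient a a b = 0.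
Proof. by rewrite /orient; ring. Qed.

Lemma orientaba a b : orient a b a = 0.
Proof. by rewrite /orient; ring. Qed.

Lemma orientabb a b : orient a b b = 0.
Proof. by rewrite /orient; ring. Qed.

Definition orientE := (orientaab, orientaba, orientabb).

Lemma tri_rot a b d x : tri a b d x = tri b d a x.
Proof.
by rewrite /tri -(orient_rot a b d) andbC -andbA.
Qed.

Lemma tri_swap a b d x : tri a b d x = tri b a d x.
Proof.
rewrite /tri (orient_swap b a d) (orient_swap b a x) (orient_swap a d x).
by rewrite (orient_swap d b x) !mulrNN [X in _ = _ && X]andbC.
Qed.

(** Barycentric coordinates are quotients of areas; the fractions are expanded by [orient a b d] so
    that their signs can be read off from [tri]. Quantifying over linear functionals covers both
    coordinates at once. *)
Lemma triW a b d x : tri a b d x -> exists u v w : R,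
  [/\ [/\ 0 < u, 0 < v & 0 < w], u + v + w = 1
    & forall al be : R, al * X x + be * Y x =
       u * (al * X a + be * Y a) + v * (al * X b + be * Y b)
       + w * (al * X d + be * Y d)].
Proof.
move=> /and3P[h1 h2 h3].
have n0 : orient a b d != 0.
  by apply/eqP => e; move: h1; rewrite e mul0r ltxx.
have p0 : 0 < orient a b d ^+ 2 by rewrite exprn_even_gt0.
exists ((orient a b d * orient b d x) / orient a b d ^+ 2).
exists ((orient a b d * orient d a x) / orient a b d ^+ 2).
exists ((orient a b d * orient a b x) / orient a b d ^+ 2).
split; first by split; apply: divr_gt0.
- by move: n0; rewrite /orient => n0; field.
- by move: n0; rewrite /orient => n0 al be; field.
Qed.

Lemma orient_aff a b d x (u v w : R) p q : u + v + w = 1 ->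
  (forall al be : R, al * X x + be * Y x =
     u * (al * X a + be * Y a) + v * (al * X b + be * Y b)
     + w * (al * X d + be * Y d)) ->
  orient p q x = u * orient p q a + v * orient p q b + w * orient p q d.
Proof.
move=> e h; have hX := h 1 0; have hY := h 0 1.
rewrite !mul1r !mul0r !add0r ?addr0 in hX hY.
have -> : u = 1 - v - w by rewrite -e; ring.
rewrite /orient hX hY; have -> : u = 1 - v - w by rewrite -e; ring.
ring.
Qed.

Lemma triO a b d x : tri a b d x -> exists u v w : R,
  [/\ [/\ 0 < u, 0 < v & 0 < w], u + v + w = 1 &
   forall p q, orient p q x =
     u * orient p q a + v * orient p q b + w * orient p q d].
Proof.
move=> /triW[u [v [w [pos e h]]]]; exists u, v, w; split=> // p q.
exact: orient_aff.
Qed.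

Lemma tri_neq a b d x : tri a b d x ->
  [/\ a != b, b != d, a != d & [/\ x != a, x != b & x != d]].
Proof.
move=> /and3P[h1 h2 h3].
by split; [| | |split]; apply/eqP => E; move: h1 h2 h3;
  rewrite ?E !orientE ?mulr0 ?mul0r ?ltxx.
Qed.

Lemma tri_ccw a b d x : 0 < orient a b d ->
  tri a b d x = [&& 0 < orient a b x, 0 < orient b d x & 0 < orient d a x].
Proof. by move=> h; rewrite /tri !pmulr_rgt0. Qed.

Lemma tri_wlog a b d (P : T -> T -> T -> Prop) : orient a b d != 0 ->
  (forall a b d, P a b d -> P b a d) ->
  (forall a b d, 0 < orient a b d -> P a b d) -> P a b d.
Proof.
move=> n0 sw h; case: (ltrgtP (orient a b d) 0) n0 => // o _; last exact: h.
by apply/sw/h; rewrite orient_swap oppr_gt0.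
Qed.

Lemma tri_rotL a b d x : tri a b d x = tri d a b x.
Proof. by rewrite [RHS]tri_rot. Qed.

Lemma tri_swapr a b d x : tri a b d x = tri a d b x.
Proof. by rewrite tri_rot tri_swap tri_rotL. Qed.

Hypothesis gp : forall a b d, a != b -> a != d -> b != d -> orient a b d != 0.
Hypothesis Xinj : injective X.

Lemma tri_orient a b d x : tri a b d x -> orient a b d != 0.
Proof. by move=> t; case: (tri_neq t) => ? ? ? _; apply: gp. Qed.

Lemma tri_sub a b d p x : tri a b d p -> tri p a b x -> tri a b d x.
Proof.
move=> tp; move: (tp); pattern a, b, d; apply: tri_wlog (tri_orient tp) _ _.
  move=> {a b d tp}a b d h; rewrite !(tri_swap b) (tri_swapr p); exact: h.
move=> {a b d tp}a b d o0; rewrite [tri a b d p]tri_ccw // [tri a b d x]tri_ccw //.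
move=> /and3P[p1 p2 p3].
move=> /triO[u [v [w [[u0 v0 w0] _ h]]]]; rewrite !h !orientE.
rewrite -(orient_rot a b d) (orient_rot d a b) in p1 p2 p3 *.
by rewrite !mulr0 ?addr0 ?add0r !addr_gt0 ?mulr_gt0.
Qed.

(** The first factors are the unnormalised barycentric coordinates of [p], and [orient p y x] is
    affine in [y] and vanishes at [y = p]. *)
Lemma bary a b d p x :
  orient b d p * orient p a x + orient d a p * orient p b x
   + orient a b p * orient p d x = 0.
Proof. by rewrite /orient; ring. Qed.

(** By [bary], the nonzero numbers [orient p a x], [orient p b x], [orient p d x] do not all have
    the same sign. Going round the vertices, a change from positive to negative marks the
    subtriangle that contains [x]. *)
Lemma tri_split a b d p x : tri a b d p -> tri a b d x -> x != p ->
  [|| tri p a b x, tri p b d x | tri p d a x].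
Proof.
move=> tp; move: (tp); pattern a, b, d; apply: tri_wlog (tri_orient tp) _ _.
  move=> {a b d tp}a b d h; rewrite ![tri b a d _]tri_swap => tp tx xp.
  have := h tp tx xp; rewrite (tri_swapr p b a) (tri_swapr p a d) (tri_swapr p d b).
  by case/or3P=> -> //; rewrite !orbT.
move=> {a b d tp}a b d o0 tp tx xp; move: (tp) (tx).
case/tri_neq: (tp) => ab bd ad [pa pb pd]; case/tri_neq: (tx) => _ _ _ [xa xb xd].
rewrite !(tri_ccw _ o0) => /and3P[p1 p2 p3] /and3P[x1 x2 x3].
have u0 : orient p a x != 0 by apply: gp; rewrite // eq_sym.
have v0 : orient p b x != 0 by apply: gp; rewrite // eq_sym.
have w0 : orient p d x != 0 by apply: gp; rewrite // eq_sym.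
have B := bary a b d p x.
rewrite -(orient_rot p) in p1; rewrite -(orient_rot p) in p2.
rewrite -(orient_rot p) in p3.
rewrite (tri_ccw _ p1) (tri_ccw _ p2) (tri_ccw _ p3) x1 x2 x3 /=.
rewrite !(orient_swap _ p) !oppr_gt0.
rewrite -!(orient_rot p) in B.
move: u0 v0 w0 B; rewrite !neq_lt.
case: (ltP 0 (orient p a x)) => u0; case: (ltP 0 (orient p b x)) => v0;
case: (ltP 0 (orient p d x)) => w0 //=; rewrite ?orbF ?orbT // => *; nra.
Qed.

(** The line through [p] and [b] separates the two subtriangles. *)
Lemma tri_split_disj a b d p x :
  tri a b d p -> tri p a b x -> tri p b d x -> False.
Proof.
move=> /and3P[h1 h2 _] /and3P[_ _ h3] /and3P[h4 _ _].
rewrite (orient_swap b p) -!(orient_rot p) in h1 h2 h3.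
have := mulr_gt0 h1 h2; have := mulr_gt0 h3 h4.
set D := orient a b d; set A := orient p a b; set B := orient p b d.
set v := orient p b x => H1 H2.
have H3 : 0 < A * B * D ^+ 2 by rewrite (_ : _ * _ = D * A * (D * B)) //; ring.
have H4 : A * B * v ^+ 2 < 0.
  by rewrite -oppr_gt0 (_ : - _ = A * - v * (B * v)) //; ring.
have H5 : 0 < A * B.
  by case: (ltP 0 (A * B)) => // le; have := mulr_le0_ge0 le (sqr_ge0 D); lra.
by have := mulr_ge0 (ltW H5) (sqr_ge0 v); lra.
Qed.

(** * Point sets of triangles and their subdivision *)

Definition inn a b d := [set x | tri a b d x].
(** The points of the closed triangle: in general position its boundary carries only the three
    vertices. *)
Definition cl a b d := [set a; b; d] :|: inn a b d.

Lemma sub_cl a b d : [set a; b; d] \subset cl a b d.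
Proof. exact: subsetUl. Qed.

Lemma inn_rot a b d : inn a b d = inn b d a.
Proof. by apply/setP => x; rewrite !inE tri_rot. Qed.

Lemma cl_rot a b d : cl a b d = cl b d a.
Proof.
apply/setP => x; rewrite !inE tri_rot.
by case: (x == a); case: (x == b); case: (x == d).
Qed.

Lemma inn_split a b d p : p \in inn a b d ->
  [/\ inn a b d = p |: (inn p a b :|: inn p b d :|: inn p d a),
      p \notin inn p a b :|: inn p b d :|: inn p d a,
      [disjoint inn p a b & inn p b d] &
      [disjoint inn p a b :|: inn p b d & inn p d a]].
Proof.
rewrite inE => tp; have tp1 := tp; rewrite tri_rot in tp1.
have tp2 := tp1; rewrite tri_rot in tp2.
split.
- apply/setP => x; rewrite !inE; apply/idP/idP.
    by case: eqP => //= /eqP xp tx; rewrite -orbA; apply: tri_split.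
  case/or3P => [/eqP->//|/orP[]|].
  + exact: tri_sub.
  + by rewrite (tri_rot a); apply: tri_sub.
  + by rewrite (tri_rot a) (tri_rot b); apply: tri_sub.
- by rewrite !inE; apply/negP => /orP[/orP[]|] /tri_neq[_ _ _ []]; rewrite eqxx.
- apply/pred0P => x /=; rewrite !inE; apply/negP => /andP[].
  exact: tri_split_disj.
- apply/pred0P => x /=; rewrite !inE; apply/negP => /andP[/orP[h1 h2|h1 h2]].
  + exact: (tri_split_disj tp2 h2 h1).
  + exact: (tri_split_disj tp1 h1 h2).
Qed.

Lemma inn_proper a b d p : p \in inn a b d -> inn p a b \proper inn a b d.
Proof.
move=> /inn_split[E _ _ _]; rewrite properE E; apply/andP; split.
  by apply/subsetP => x xi; rewrite !in_setU xi !orbT.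
apply/subsetPn; exists p; first exact: setU11.
by rewrite inE; apply/negP => /tri_neq[_ _ _ []]; rewrite eqxx.
Qed.

(** The interiors are disjoint and no vertex of the large triangle is interior to it, so only the
    ends of the common side are shared. *)
Lemma cl_meet a b d p : p \in inn a b d ->
  cl p a b :&: cl p b d \subset [set p; b].
Proof.
move=> pi; have tp : tri a b d p by rewrite inE in pi.
have [E _ dj _] := inn_split pi.
case/tri_neq: (tp) => ab bd ad [pa pb pd].
have notin z : z \in [set a; b; d] -> z \notin inn a b d.
  rewrite !inE => /orP[/orP[]|] /eqP->; apply/negP => /tri_neq[_ _ _ []];
  by rewrite eqxx.
have s1 : inn p a b \subset inn a b d.
  by rewrite E; apply/subsetP => x xi; rewrite !inE in xi *; rewrite xi !orbT.
have s2 : inn p b d \subset inn a b d.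
  by rewrite E; apply/subsetP => x xi; rewrite !inE in xi *; rewrite xi !orbT.
apply/subsetP => x; rewrite !in_setI /cl.
rewrite in_setU (in_setU x _ (inn p b d)) => /andP[/orP[x1|x1] /orP[x2|x2]].
- move: x1 x2; rewrite !inE; case: (x == p) (x == b) => [] [] //=.
  by rewrite ?orbF => /eqP-> /eqP E'; rewrite E' eqxx in ad.
- have := subsetP s2 _ x2; move: x1; rewrite !inE.
  case/orP=> [/orP[->//|/eqP->]|->]; last by rewrite orbT.
  by move=> h; have := notin a; rewrite !inE eqxx h => /(_ isT).
- have := subsetP s1 _ x1; move: x2; rewrite !inE.
  case/orP=> [/orP[->//|->]|/eqP->]; first by rewrite orbT.
  by move=> h; have := notin d; rewrite !inE eqxx h !orbT => /(_ isT).
- by move/pred0P: dj => /(_ x) /=; rewrite x1 x2.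
Qed.

Lemma cl_sub a b d p : p \in inn a b d -> cl p a b \subset cl a b d.
Proof.
move=> pi; have [E _ _ _] := inn_split pi.
apply/subsetP => x; rewrite /cl !(in_setU x _ (inn _ _ _)) => /orP[|].
  rewrite !inE => /orP[/orP[/eqP->|->]|->]; rewrite ?orbT //.
  by rewrite inE in pi; rewrite pi orbT.
by rewrite E => xi; rewrite !in_setU xi /= !orbT.
Qed.

(** * Weights and good triangles *)

(* There are c = e + 1 colours, so a triangle is good when it has fewer than [e]
   points inside. *)
Variables (e : nat) (chi : T -> 'I_e.+1) (good : pred {set T}).
Hypothesis e_gt0 : (0 < e)%N.
Hypothesis goodP : forall a b d, a != b -> b != d -> a != d ->
  chi a = chi b -> chi b = chi d -> (#|inn a b d| < e)%N -> good [set a; b; d].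

Local Notation goods := (goods good).

Definition weight (j : 'I_e.+1) (A : {set T}) : int :=
  \sum_(x in A) (if chi x == j then e%:Z else -1).

Lemma weightU j (A B : {set T}) : [disjoint A & B] ->
  weight j (A :|: B) = weight j A + weight j B.
Proof. by move=> dj; rewrite -bigU //; apply: eq_bigl => x; rewrite !inE. Qed.

Lemma weight1 j x : weight j [set x] = if chi x == j then e%:Z else -1.
Proof. by rewrite /weight big_set1. Qed.

Lemma weight_card j A :
  weight j A = (e.+1 * #|[set x in A | chi x == j]|)%:Z - #|A|%:Z.
Proof.
rewrite /weight (bigID (fun x => chi x == j)) /=.
rewrite (eq_bigr (fun _ => e%:Z)) => [|x /andP[_ ->] //].
rewrite [X in _ + X](eq_bigr (fun _ => -1)) => [|x /andP[_ /negPf->] //].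
rewrite -big_set /= sumr_const.
rewrite -(big_set _ _ (fun x => (x \in A) && (chi x != j))) /= sumr_const.
have -> : #|A| = (#|[set x in A | chi x == j]| +
  #|[set x in A | chi x != j]|)%N.
  rewrite -(cardsID [set x | chi x == j] A); congr (_ + _)%N; apply: eq_card => x.
    by rewrite !inE.
  by rewrite !inE andbC.
move: #|_| #|_| => p q; rewrite mulNrn.
rewrite -mulr_natr !natz PoszM PoszD intS; ring.
Qed.

Lemma weight_nored j (A : {set T}) : (forall x, x \in A -> chi x != j) ->
  weight j A = - #|A|%:Z.
Proof.
move=> h; rewrite weight_card (_ : [set x in A | _] = set0) ?cards0; first by lia.
by apply/setP => x; rewrite !inE; apply/negP => /andP[/h /negPf->].
Qed.

Lemma weight_split j a b d p : p \in inn a b d ->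
  weight j (inn a b d) = weight j [set p] + weight j (inn p a b)
    + weight j (inn p b d) + weight j (inn p d a).
Proof.
move=> pi; have [E pn d1 d2] := inn_split pi.
rewrite E weightU; last by rewrite disjoints1.
by rewrite weightU // weightU // !addrA.
Qed.

Lemma card_cl_meet a b d p : p \in inn a b d ->
  (#|cl p a b :&: cl p b d| <= 2)%N.
Proof.
move=> /cl_meet /subset_leq_card /leq_trans; apply.
by rewrite cards2; case: (_ != _).
Qed.

(* Splitting at a point [q] of colour [j] for which the triangle opposite to [a]
   has no point of colour [j] inside keeps all triangles incident to [a]. *)
Lemma star j a b d : a != b -> b != d -> a != d ->
  chi a = j -> chi b = j -> chi d = j ->
  weight j (inn a b d) + e%:Z <= e%:Z * #|goods (cl a b d) [set a]|%:Z.
Proof.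
have [n] := ubnP #|inn a b d|; elim: n a b d => // n IH a b d.
rewrite ltnS => le_n ab bd ad ca cb cd.
case: (pickP (fun x => (x \in inn a b d) && (chi x == j))) => [q0 q0P|none].
  (* A point of colour [j] inside [q b d] would span a strictly smaller triangle with [b] and [d];
     the minimal choice therefore leaves none there. *)
  have [q /andP[qi /eqP cq] qmin] := @arg_minnP _ q0
    (fun x => (x \in inn a b d) && (chi x == j)) (fun x => #|inn x b d|) q0P.
  have tq : tri a b d q by rewrite inE in qi.
  case/tri_neq: (tq) => _ _ _ [qa qb qd].
  have nored x : x \in inn q b d -> chi x != j.
    move=> xi; apply/negP => cx.
    have qi' : q \in inn b d a by rewrite -inn_rot.
    have xi' : x \in inn b d a.
      by have [-> _ _ _] := inn_split qi'; rewrite !in_setU xi orbT.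
    have xi2 : x \in inn a b d by rewrite inn_rot.
    have := qmin x; rewrite xi2 cx => /(_ isT); apply/negP; rewrite -ltnNge.
    have xi3 : x \in inn b d q by rewrite -inn_rot.
    by apply: proper_card; rewrite (inn_rot q); apply: inn_proper.
  have W := weight_split j qi.
  have wqbd := weight_nored nored.
  have l1 : (#|inn q a b| < n)%N.
    exact: leq_trans (proper_card (inn_proper qi)) le_n.
  have qi3 : q \in inn d a b by rewrite inn_rot.
  have l2 : (#|inn q d a| < n)%N.
    by apply: leq_trans (proper_card (inn_proper qi3)) _; rewrite inn_rot.
  have i1 : weight j (inn a b q) + e%:Z <= e%:Z * #|goods (cl a b q) [set a]|%:Z.
    by apply: IH; rewrite // 1?eq_sym // -inn_rot.
  have i2 : weight j (inn a q d) + e%:Z <= e%:Z * #|goods (cl a q d) [set a]|%:Z.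
    by apply: IH; rewrite // 1?eq_sym // inn_rot.
  have qi' : q \in inn d a b by rewrite inn_rot.
  have M : (#|cl a b q :&: cl a q d| <= 2)%N.
    by rewrite setIC (cl_rot a) -(cl_rot q a b) card_cl_meet.
  have s1 : cl a b q \subset cl a b d by rewrite -cl_rot; apply: cl_sub.
  have s2 : cl a q d \subset cl a b d.
    by rewrite (cl_rot a) -(cl_rot d); apply: cl_sub.
  have := card_goods2 good s1 s2 (subxx [set a]) (subxx [set a]) M.
  rewrite W weight1 cq eqxx wqbd.
  rewrite -inn_rot in i1; rewrite inn_rot in i2; move=> lg.
  apply: (@le_trans _ _ (e%:Z *
    (#|goods (cl a b q) [set a]| + #|goods (cl a q d) [set a]|)%N%:Z)); last first.
    by rewrite ler_wpM2l.
  (* The weight [e] of [q] accounts for the second additive [e]; the slack is the number of points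
     in [inn q b d]. *)
  rewrite PoszD mulrDr; apply: le_trans (lerD i1 i2).
  rewrite -subr_ge0 (_ : _ - _ = #|inn q b d|%:Z) //; ring.
have nr x : x \in inn a b d -> chi x != j.
  by move=> xi; have := none x; rewrite xi /= => ->.
rewrite (weight_nored nr).
(* With no point of the colour inside, either at least [e] other points make the left side
   nonpositive, or the triangle itself is good. *)
case: (ltnP #|inn a b d| e) => [lt|ge]; last first.
  by apply: (@le_trans _ _ 0); [lia|rewrite mulr_ge0].
have : (0 < #|goods (cl a b d) [set a]|)%N.
  apply/card_gt0P; exists [set a; b; d]; rewrite inE goodP ?ca ?cb ?cd //=.
  rewrite card3 // sub_cl /=.
  by apply/pred0Pn; exists a; rewrite /= !inE eqxx.
rewrite -lez_nat => g0; apply: (@le_trans _ _ (e%:Z * 1)); first by lia.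
by rewrite ler_wpM2l.
Qed.

(* Each link of the chain contributes one triangle more than a star would. *)
Lemma chain j a b d qs : a != b -> b != d -> a != d ->
  chi a = j -> chi b = j -> chi d = j -> {in qs, forall q, chi q = j} ->
  path (fun p q => tri p b d q) a qs ->
  weight j (inn a b d) + e%:Z * (size qs).+1%:Z
    <= e%:Z * #|goods (cl a b d) [set b; d]|%:Z.
Proof.
elim: qs a => [|q qs IH] a ab bd ad ca cb cd cqs /=.
  move=> _; rewrite mulr1 inn_rot.
  apply: (le_trans (star bd _ _ cb cd ca)); rewrite // 1?eq_sym //.
  rewrite ler_wpM2l // lez_nat (cl_rot a); apply/subset_leq_card/goodsS => //.
  by rewrite sub1set !inE eqxx.
move=> /andP[tq pq]; have [_ _ _ [qa qb qd]] := tri_neq tq.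
have qi : q \in inn a b d by rewrite inE.
have qi2 : q \in inn b d a by rewrite -inn_rot.
have qi3 : q \in inn d a b by rewrite inn_rot.
have cq : chi q = j by apply: cqs; rewrite mem_head.
have i1 : weight j (inn q a b) + e%:Z <= e%:Z * #|goods (cl q a b) [set b]|%:Z.
  by rewrite 2!inn_rot 2!cl_rot; apply: star; rewrite // 1?eq_sym.
have i2 : weight j (inn q d a) + e%:Z <= e%:Z * #|goods (cl q d a) [set d]|%:Z.
  by rewrite inn_rot cl_rot; apply: star; rewrite // 1?eq_sym.
have cqs' : {in qs, forall q, chi q = j}.
  by move=> y yq; apply: cqs; rewrite inE yq orbT.
have i3 := IH q qb bd qd cq cb cd cqs' pq.
have s1 := cl_sub qi.
have s2 := cl_sub qi2; rewrite -(cl_rot a b d) in s2.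
have s3 := cl_sub qi3; rewrite (cl_rot d a b) in s3.
have := @card_goods3 T good (cl a b d) (cl q a b) (cl q d a) (cl q b d)
  [set b; d] [set b] [set d] [set b; d] s1 s3 s2.
rewrite !sub1set !inE !eqxx orbT subxx => /(_ isT isT isT).
rewrite (setIC (cl q a b) (cl q d a)) (setIC (cl q d a) (cl q b d)).
rewrite !(card_cl_meet) // => /(_ isT isT isT) le.
(* The additive terms balance exactly: two stars and the remaining chain supply [e] times
   [size qs + 3], of which the weight of [q] takes one [e]. *)
rewrite (weight_split _ qi) weight1 cq eqxx.
apply: (@le_trans _ _ (e%:Z * (#|goods (cl q a b) [set b]|
  + #|goods (cl q d a) [set d]| + #|goods (cl q b d) [set b; d]|)%N%:Z)); last first.
  by rewrite ler_wpM2l.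
rewrite 2!PoszD 2!mulrDr; apply: le_trans (lerD (lerD i1 i2) i3).
by rewrite /= [(size qs).+2%:Z]intS -subr_ge0 (_ : _ - _ = 0) //; ring.
Qed.

(** Otherwise each point lies in the triangle that the other spans with [d] and [a]; nesting these
    puts [q] inside a triangle with vertex [q]. *)
Lemma tri_comparable a b d p q : p \in inn a b d -> q \in inn a b d -> p != q ->
  [|| tri p b d q, tri q b d p, tri p a b q | tri q a b p].
Proof.
move=> pi qi pq; case: (boolP (tri p b d q)) => //= n1.
case: (boolP (tri q b d p)) => //= n2.
case: (boolP (tri p a b q)) => //= n3; apply: contraT => n4.
have tp : tri a b d p by rewrite inE in pi.
have tq : tri a b d q by rewrite inE in qi.
have := tri_split tp tq; rewrite eq_sym pq => /(_ isT).
rewrite (negPf n1) (negPf n3) /= => h1.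
have := tri_split tq tp pq; rewrite (negPf n2) (negPf n4) /= => h2.
have sq : tri d a q q by apply: (tri_sub) h1; rewrite -tri_rot.
by case: (tri_neq sq) => _ _ _ []; rewrite eqxx.
Qed.

(* Of any two interior points, one lies in the triangle that the other spans
   with [b, d] or with [a, b]; so a long antichain for the first relation is
   a chain for the second. *)
Lemma long_chain j s a b d : a != b -> b != d -> a != d ->
  chi a = j -> chi b = j -> chi d = j ->
  (s * s < #|[set x in inn a b d | chi x == j]|)%N ->
  weight j (inn a b d) + e%:Z * s.+2%:Z
    <= e%:Z * #|goods (cl a b d) [set a; b; d]|%:Z.
Proof.
move=> ab bd ad ca cb cd /(chain_or_antichain (fun p q => tri p b d q)).
case=> [[l [sl lA sz]]|[B [BA uB Bac]]].
  have lj : {in l, forall q, chi q = j}.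
    by move=> q /lA; rewrite inE => /andP[_ /eqP].
  have pl : path (fun p q => tri p b d q) a l.
    case: l sl lA {sz lj} => //= x l -> /(_ x (mem_head _ _)).
    by rewrite !inE andbT => /andP[].
  have := chain ab bd ad ca cb cd lj pl; rewrite sz.
  move/le_trans; apply; rewrite ler_wpM2l // lez_nat.
  by apply/subset_leq_card/goodsS => //; rewrite -setUA subsetUr.
(* With threshold 1 the second alternative yields two points unrelated in both relations, which
   [tri_comparable] excludes. *)
move: uB; rewrite -[s]muln1 => /(chain_or_antichain (fun p q => tri p a b q)).
have da : d != a by rewrite eq_sym.
have db : d != b by rewrite eq_sym.
case=> [[l [sl lB sz]]|[B' [BB uB' Bac']]].
  have lA x : x \in l -> x \in [set x in inn a b d | chi x == j].
    by move=> /lB; apply/subsetP.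
  have lj : {in l, forall q, chi q = j}.
    by move=> q /lA; rewrite inE => /andP[_ /eqP].
  have pl : path (fun p q => tri p a b q) d l.
    case: l sl lA {sz lj lB} => //= x l -> /(_ x (mem_head _ _)).
    by rewrite !inE andbT => /andP[]; rewrite [in X in _ -> X]tri_rot.
  have := chain da ab db cd ca cb lj pl; rewrite sz muln1.
  rewrite inn_rot cl_rot; move/le_trans; apply; rewrite ler_wpM2l // lez_nat.
  by apply/subset_leq_card/goodsS => //; rewrite subsetUl.
have /card_gt1P[p [q [pB qB pq]]] := uB'.
have Bi x : x \in B' -> x \in inn a b d.
  by move=> /(subsetP BB) /(subsetP BA); rewrite inE => /andP[].
have := tri_comparable (Bi _ pB) (Bi _ qB) pq.
have := Bac _ _ (subsetP BB _ pB) (subsetP BB _ qB) => /negPf->.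
have := Bac _ _ (subsetP BB _ qB) (subsetP BB _ pB) => /negPf->.
by rewrite (negPf (Bac' _ _ pB qB)) (negPf (Bac' _ _ qB pB)).
Qed.

(** [sl] orders [U] by angle around [p]. The induction cuts off the sector after the second to last
    point [q'] of the colour: it contains just one such point [q], and unless the triangle [p q' q]
    is good, its weight is at most 0. *)
Lemma half_star j p (U : {set T}) (sl : T -> R) : p \notin U -> chi p = j ->
  {in U &, injective sl} ->
  (forall u v x, u \in U -> v \in U -> sl u < sl v -> tri p u v x ->
     x \in U /\ sl u < sl x < sl v) ->
  weight j U <= e%:Z * #|goods (p |: U) [set p]|%:Z + e%:Z.
Proof.
have [n] := ubnP #|U|; elim: n U => // n IH U; rewrite ltnS.
move=> leU pU cp inj cU.
case: (pickP (fun x => (x \in U) && (chi x == j))) => [q0 q0P|none]; last first.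
  have nr x : x \in U -> chi x != j by move=> xi; have := none x; rewrite xi /= => ->.
  rewrite (weight_nored nr); apply: (@le_trans _ _ 0); first by lia.
  by rewrite addr_ge0 // mulr_ge0.
have [q /andP[qU /eqP cq] qmax] := @arg_maxP _ _ T q0
  (fun x => (x \in U) && (chi x == j)) sl q0P.
case: (pickP (fun x => [&& x \in U, chi x == j & x != q])) => [q1 q1P|none]; last first.
  (* A single point of the colour can give weight [e] without any triangle, whence the additive
     [e]. *)
  rewrite weight_card (_ : [set x in U | _] = [set q]).
    have : (0 < #|U|)%N by apply/card_gt0P; exists q.
    rewrite cards1 muln1 => U0.
    have : 0 <= e%:Z * #|goods (p |: U) [set p]|%:Z by rewrite mulr_ge0.
    rewrite intS; move: (_ * _) => g g0; lia.
  apply/setP => x; rewrite !inE; apply/idP/eqP => [/andP[xU cx]|->].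
    by have := none x; rewrite xU cx /= => /eqP.
  by rewrite qU cq eqxx.
have [q' /and3P[q'U /eqP cq' q'q] q'max] := @arg_maxP _ _ T q1
  (fun x => [&& x \in U, chi x == j & x != q]) sl q1P.
have ltq : sl q' < sl q.
  rewrite lt_neqAle (inj_in_eq inj) // q'q /=; apply: qmax.
  by rewrite q'U cq' eqxx.
pose U1 := [set x in U | sl x <= sl q'].
pose U2 := [set x in U | sl q' < sl x].
have EU : U = U1 :|: U2.
  by apply/setP => x; rewrite !inE -andb_orr leNgt orNb andbT.
have dj : [disjoint U1 & U2].
  apply/pred0P => x /=; rewrite !inE; apply/negP.
  by move=> /andP[/andP[_ h] /andP[_]]; rewrite ltNge h.
have qU2 : q \in U2 by rewrite inE qU ltq.
have U1U : U1 \subset U by apply/subsetP => x; rewrite inE => /andP[].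
have W2 : weight j U2 = e.+1%:Z - #|U2|%:Z.
  rewrite weight_card (_ : [set x in U2 | _] = [set q]) ?cards1 ?muln1 //.
  apply/setP => x; rewrite !inE; apply/idP/eqP => [/andP[/andP[xU lx] cx]|->].
    apply/eqP; apply: contraLR lx => xq; rewrite -leNgt; apply: q'max.
    by rewrite xU cx.
  by rewrite qU ltq cq eqxx.
have pU1 : p \notin U1 by apply: contra pU; apply/subsetP.
have lt1 : (#|U1| < n)%N.
  apply: leq_trans leU; apply: proper_card; rewrite properE U1U /=.
  by apply/subsetPn; exists q => //; rewrite inE qU -ltNge.
have inj1 : {in U1 &, injective sl}.
  by move=> x y xU yU; apply: inj; apply: (subsetP U1U).
have i1 := IH U1 lt1 pU1 cp inj1.
have {i1}i1 : weight j U1 <= e%:Z * #|goods (p |: U1) [set p]|%:Z + e%:Z.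
  apply: i1 => u v x; rewrite !inE => /andP[uU lu] /andP[vU lv] luv tx.
  have [xU /andP[lx1 lx2]] := cU _ _ _ uU vU luv tx.
  by rewrite xU lx1 lx2 (le_trans (ltW lx2) lv).
rewrite EU weightU //.
have sg : goods (p |: U1) [set p] \subset goods (p |: (U1 :|: U2)) [set p].
  by apply: goodsS => //; apply: setUS; apply: subsetUl.
have inU2 : inn p q' q \subset U2 :\ q.
  apply/subsetP => x; rewrite inE => tx.
  have [xU /andP[l1 l2]] := cU _ _ _ q'U qU ltq tx.
  by rewrite !inE xU l1 !andbT; apply/eqP => E; rewrite E ltxx in l2.
have c2 : #|U2| = (#|U2 :\ q|).+1 by rewrite (cardsD1 q) qU2.
have le2 := subset_leq_card inU2.
have le1 : e%:Z * #|goods (p |: U1) [set p]|%:Z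
  <= e%:Z * #|goods (p |: (U1 :|: U2)) [set p]|%:Z.
  by rewrite ler_wpM2l // lez_nat subset_leq_card.
(* A bad triangle forces at least [e] points besides [q] into [U2]. A good one pays for the weight
   of [U2], at most [e], and is new because [q] is not in [U1]. *)
case: (ltnP #|inn p q' q| e) => [lt|ge]; last first.
  rewrite W2 c2 -[X in _ <= X]addr0; apply: lerD; last first.
    move: ge le2; move: #|inn p q' q| #|U2 :\ q| => k m; clear; lia.
  by apply: le_trans i1 _; rewrite lerD2r.
have pq' : p != q' by apply: contraNneq pU => ->.
have pq : p != q by apply: contraNneq pU => ->.
have t0 : [set p; q'; q] \in goods (p |: (U1 :|: U2)) [set p].
  rewrite inE goodP ?cp ?cq ?cq' // card3 //= -EU; apply/andP; split.
    by apply/subsetP => x; rewrite !inE => /orP[/orP[->|/eqP->]|/eqP->] //;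
       rewrite ?q'U ?qU orbT.
  by apply/pred0Pn; exists p; rewrite /= !inE eqxx.
have t1 : [set p; q'; q] \notin goods (p |: U1) [set p].
  rewrite inE; apply/negP => /and4P[_ _ /subsetP/(_ q) + _].
  rewrite !inE eqxx orbT => /(_ isT); rewrite eq_sym (negPf pq) /= leNgt ltq andbF.
  by [].
have lt2 : (#|goods (p |: U1) [set p]| < #|goods (p |: (U1 :|: U2)) [set p]|)%N.
  by apply: proper_card; rewrite properE sg; apply/subsetPn; exists [set p; q'; q].
have {le1 lt2}: e%:Z * #|goods (p |: U1) [set p]|.+1%:Z
  <= e%:Z * #|goods (p |: (U1 :|: U2)) [set p]|%:Z.
  by rewrite ler_wpM2l // lez_nat.
rewrite intS mulrDr mulr1 W2 c2; move: i1.
move: (weight j U1) (e%:Z * _) (e%:Z * _) => w g1 g2; clear; lia.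
Qed.

(** * Convex sets and extreme points *)

Definition slope p x := (Y x - Y p) / (X x - X p).

Lemma orient_slope p u v : X u - X p != 0 -> X v - X p != 0 ->
  orient p u v = (X u - X p) * (X v - X p) * (slope p v - slope p u).
Proof. by move=> u0 v0; rewrite /slope /orient; field; rewrite u0 v0. Qed.

Lemma slope_lt p u v : 0 < (X u - X p) * (X v - X p) ->
  (slope p u < slope p v) = (0 < orient p u v).
Proof.
move=> uv; have : (X u - X p) * (X v - X p) != 0 by rewrite gt_eqF.
rewrite mulf_eq0 negb_or => /andP[u0 v0].
by rewrite orient_slope // pmulr_rgt0 // subr_gt0.
Qed.

Lemma slope_tri p u v x : 0 < (X u - X p) * (X v - X p) ->
  slope p u < slope p v -> tri p u v x ->
  0 < (X u - X p) * (X x - X p) /\ slope p u < slope p x < slope p v.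
Proof.
move=> uv; rewrite slope_lt // => ouv /triW[k [l [m [[k0 l0 m0] klm1 h]]]].
have hX := h 1 0; rewrite !mul1r !mul0r !addr0 in hX.
have E : X x - X p = l * (X u - X p) + m * (X v - X p).
  by rewrite hX (_ : k = 1 - l - m); [ring|rewrite -klm1; ring].
have u2 : 0 < (X u - X p) ^+ 2.
  by rewrite exprn_even_gt0 //=; apply/eqP => z; move: uv; rewrite z mul0r ltxx.
have v2 : 0 < (X v - X p) ^+ 2.
  by rewrite exprn_even_gt0 //=; apply/eqP => z; move: uv; rewrite z mulr0 ltxx.
have ux : 0 < (X u - X p) * (X x - X p).
  rewrite E (_ : _ * _ = l * (X u - X p) ^+ 2 + m * ((X u - X p) * (X v - X p))).
    by rewrite addr_gt0 // mulr_gt0.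
  by ring.
have xv : 0 < (X x - X p) * (X v - X p).
  rewrite E (_ : _ * _ = l * ((X u - X p) * (X v - X p)) + m * (X v - X p) ^+ 2).
    by rewrite addr_gt0 // mulr_gt0.
  by ring.
split=> //; rewrite !slope_lt //.
have hO q r := orient_aff q r klm1 h.
have -> : orient p x v = - orient p v x by rewrite /orient; ring.
rewrite !hO !(orientaab, orientaba, orientabb).
have -> : orient p v u = - orient p u v by rewrite /orient; ring.
by rewrite !mulr0 ?addr0 ?add0r mulrN opprK !mulr_gt0.
Qed.

(** Convexity relative to the finite point set, tested on triangles only. *)
Definition closed (Q : {set T}) := forall a b d x,
  a \in Q -> b \in Q -> d \in Q -> tri a b d x -> x \in Q.

Lemma closed_lt0 Q u v : closed Q -> closed [set x in Q | orient u v x < 0].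
Proof.
move=> cQ a b d x; rewrite !inE => /andP[aQ oa] /andP[bQ ob] /andP[dQ od] tx.
rewrite (cQ _ _ _ _ aQ bQ dQ tx) /=.
have [k [l [m [[k0 l0 m0] _ ->]]]] := triO tx.
by rewrite -oppr_gt0 !opprD !addr_gt0 // oppr_gt0 pmulr_rlt0.
Qed.

Lemma closed_ge0 Q u v : closed Q -> closed [set x in Q | 0 <= orient u v x].
Proof.
move=> cQ a b d x; rewrite !inE => /andP[aQ oa] /andP[bQ ob] /andP[dQ od] tx.
rewrite (cQ _ _ _ _ aQ bQ dQ tx) /=.
have [k [l [m [[k0 l0 m0] _ ->]]]] := triO tx.
by rewrite !addr_ge0 // mulr_ge0 // ltW.
Qed.

Definition lin (al be : R) x := al * X x + be * Y x.

(** The points in the convex hull of [S], described dually: no linear functional exceeds its maximum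
    on [S]. *)
Definition hullset (S : {set T}) := [set x | `[< forall al be,
  exists2 s, s \in S & lin al be x <= lin al be s >]].

(* The points of [S] on the boundary of its convex hull; in general position
   these are its extreme points. *)
Definition ext (S : {set T}) := [set x in S | `[< exists al be,
  (al != 0) || (be != 0) /\ forall s, s \in S -> lin al be s <= lin al be x >]].

Lemma sub_hullset (S : {set T}) : S \subset hullset S.
Proof. by apply/subsetP => x xS; rewrite inE; apply/asboolP => al be; exists x. Qed.

Lemma ext_sub (S : {set T}) : ext S \subset S.
Proof. by apply/subsetP => x; rewrite inE => /andP[]. Qed.

(** A functional maximal at [x], a proper convex combination of [a], [b], [d], takes the same value
    at all three; being nonzero, it would make them collinear. *)
Lemma ext_not_tri S a b d x : x \in ext S -> a \in hullset S ->
  b \in hullset S -> d \in hullset S -> ~~ tri a b d x.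
Proof.
rewrite !inE => /andP[xS /asboolP[al [be [n0 xmax]]]].
move=> /asboolP ha /asboolP hb /asboolP hd; apply/negP => tx.
have le y : (forall al be, exists2 s, s \in S & lin al be y <= lin al be s) ->
    lin al be y <= lin al be x.
  by move=> hy; have [s /xmax sS /le_trans] := hy al be; apply.
have {}ha := le _ ha; have {}hb := le _ hb; have {}hd := le _ hd.
have o0 := tri_orient tx.
have [k [l [m [[k0 l0 m0] klm1 h]]]] := triW tx.
have {}h := h al be; rewrite -!/(lin _ _ _) in h.
have sa : k * (lin al be x - lin al be a) >= 0 by rewrite mulr_ge0 ?subr_ge0 // ltW.
have sb : l * (lin al be x - lin al be b) >= 0 by rewrite mulr_ge0 ?subr_ge0 // ltW.
have sd : m * (lin al be x - lin al be d) >= 0 by rewrite mulr_ge0 ?subr_ge0 // ltW.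
have s0 : k * (lin al be x - lin al be a) + l * (lin al be x - lin al be b)
  + m * (lin al be x - lin al be d) = 0.
  transitivity ((k + l + m) * lin al be x
    - (k * lin al be a + l * lin al be b + m * lin al be d)); first by ring.
  by rewrite klm1 mul1r -h subrr.
have ea : lin al be a = lin al be x.
  have : k * (lin al be x - lin al be a) = 0 by lra.
  by move/eqP; rewrite mulf_eq0 gt_eqF //= subr_eq0 => /eqP->.
have eb : lin al be b = lin al be x.
  have : l * (lin al be x - lin al be b) = 0 by lra.
  by move/eqP; rewrite mulf_eq0 gt_eqF //= subr_eq0 => /eqP->.
have ed : lin al be d = lin al be x.
  have : m * (lin al be x - lin al be d) = 0 by lra.
  by move/eqP; rewrite mulf_eq0 gt_eqF //= subr_eq0 => /eqP->.
have h1 : al * (X b - X a) + be * (Y b - Y a) = 0.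
  by rewrite -[RHS](subrr (lin al be x)) -{1}eb -ea /lin; ring.
have h2 : al * (X d - X a) + be * (Y d - Y a) = 0.
  by rewrite -[RHS](subrr (lin al be x)) -{1}ed -ea /lin; ring.
have := o0; apply/negP; rewrite negbK; case/orP: n0 => n0.
  apply/eqP/(mulfI n0); rewrite mulr0 /orient.
  transitivity ((al * (X b - X a) + be * (Y b - Y a)) * (Y d - Y a)
    - (al * (X d - X a) + be * (Y d - Y a)) * (Y b - Y a)); first by ring.
  by rewrite h1 h2 !mul0r subrr.
apply/eqP/(mulfI n0); rewrite mulr0 /orient.
transitivity ((al * (X d - X a) + be * (Y d - Y a)) * (X b - X a)
  - (al * (X b - X a) + be * (Y b - Y a)) * (X d - X a)); first by ring.
by rewrite h1 h2 !mul0r subrr.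
Qed.

(* Removing extreme points of [S] keeps the set closed, since none of them is
   interior to a triangle with vertices in the hull of [S]. *)
Lemma closed_peel (Q S E : {set T}) : closed Q -> E \subset ext S ->
  closed ((Q :&: hullset S) :\: E).
Proof.
move=> cQ ES a b d x; rewrite !in_setD !in_setI.
move=> /andP[aE /andP[aQ aS]] /andP[bE /andP[bQ bS]] /andP[dE /andP[dQ dS]] tx.
rewrite (cQ _ _ _ _ aQ bQ dQ tx) /=; apply/andP; split.
  by apply: contraL tx => /(subsetP ES) xe; exact: ext_not_tri xe aS bS dS.
rewrite inE; apply/asboolP => al be.
have [k [l [m [[k0 l0 m0] klm1 h]]]] := triW tx.
have {}h := h al be; rewrite -!/(lin _ _ _) in h.
move: aS bS dS; rewrite !inE => /asboolP/(_ al be)[s1 s1S h1].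
move=> /asboolP/(_ al be)[s2 s2S h2] /asboolP/(_ al be)[s3 s3S h3].
case: (leP (lin al be x) (lin al be a)) => xa.
  by exists s1 => //; apply: le_trans h1.
case: (leP (lin al be x) (lin al be b)) => xb.
  by exists s2 => //; apply: le_trans h2.
case: (leP (lin al be x) (lin al be d)) => xd.
  by exists s3 => //; apply: le_trans h3.
have : 0 < k * (lin al be x - lin al be a) + l * (lin al be x - lin al be b)
  + m * (lin al be x - lin al be d) by rewrite !addr_gt0 // mulr_gt0 // subr_gt0.
rewrite (_ : _ + _ + _ = (k + l + m) * lin al be x
    - (k * lin al be a + l * lin al be b + m * lin al be d)); last by ring.
by rewrite klm1 mul1r -h subrr ltxx.
Qed.

(** * Good triangles from convex sets of large weight *)

Lemma side_star j p (U : {set T}) : chi p = j ->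
  {in U &, forall u v, 0 < (X u - X p) * (X v - X p)} ->
  (forall u v x, u \in U -> v \in U -> tri p u v x ->
     0 < (X u - X p) * (X x - X p) -> x \in U) ->
  weight j U <= e%:Z * #|goods (p |: U) [set p]|%:Z + e%:Z.
Proof.
move=> cp same cU; apply: (half_star (sl := slope p)) => //.
- by apply/negP => pU; have := same _ _ pU pU; rewrite subrr mul0r ltxx.
- move=> u v uU vU E; apply/eqP; apply: contraT => uv.
  have neq x : x \in U -> p != x.
    by move=> xU; apply: contraTneq (same _ _ xU xU) => ->; rewrite subrr mul0r ltxx.
  have := gp (neq _ uU) (neq _ vU) uv.
  have := same _ _ uU vU => s0.
  have : (X u - X p) * (X v - X p) != 0 by rewrite gt_eqF.
  rewrite mulf_eq0 negb_or => /andP[u0 v0].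
  by rewrite orient_slope // E subrr mulr0 eqxx.
- move=> u v x uU vU uv tx; have [ux ?] := slope_tri (same _ _ uU vU) uv tx.
  by split=> //; apply: (cU u v).
Qed.

(** The vertical line through [p] cuts [Q] into two sectors with a loss of [e] each, and [p] itself
    has weight [e]. *)
Lemma closed_star j p Q : closed Q -> p \in Q -> chi p = j ->
  weight j Q <= e%:Z * #|goods Q [set p]|%:Z + (3 * e)%N%:Z.
Proof.
move=> cQ pQ cp.
pose U1 := [set x in Q | X p < X x]; pose U2 := [set x in Q | X x < X p].
have EQ : Q = p |: (U1 :|: U2).
  apply/setP => x; rewrite !inE -andb_orr -neq_lt (inj_eq Xinj) (eq_sym p).
  by case: eqP => [->|_] //=; rewrite ?pQ // andbT.
have pU1 : p \notin U1 by rewrite inE ltxx andbF.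
have pU2 : p \notin U2 by rewrite inE ltxx andbF.
have dj : [disjoint U1 & U2].
  apply/pred0P => x /=; apply/negP; rewrite !inE => /andP[/andP[_ h] /andP[_]].
  by rewrite ltNge (ltW h).
have w1 : weight j U1 <= e%:Z * #|goods (p |: U1) [set p]|%:Z + e%:Z.
  apply: side_star => // [u v|u v x].
    by rewrite !inE => /andP[_ u0] /andP[_ v0]; rewrite mulr_gt0 // subr_gt0.
  rewrite !inE => /andP[uQ u0] /andP[vQ v0] tx.
  by rewrite pmulr_rgt0 subr_gt0 // => ->; rewrite (cQ _ _ _ _ pQ uQ vQ tx).
have w2 : weight j U2 <= e%:Z * #|goods (p |: U2) [set p]|%:Z + e%:Z.
  apply: side_star => // [u v|u v x].
    by rewrite !inE => /andP[_ u0] /andP[_ v0]; rewrite nmulr_rgt0 subr_lt0.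
  rewrite !inE => /andP[uQ u0] /andP[vQ v0] tx.
  by rewrite nmulr_rgt0 subr_lt0 // => ->; rewrite (cQ _ _ _ _ pQ uQ vQ tx).
have := @card_goods2 T good Q (p |: U1) (p |: U2) [set p] [set p] [set p].
rewrite subxx {1 2}EQ !setUS ?subsetUl ?subsetUr // => /(_ isT isT isT isT).
rewrite -setUIr disjoint_setI0 // setU0 cards1 => /(_ isT) le.
rewrite {1}EQ weightU; last by rewrite disjoints1 in_setU negb_or pU1.
rewrite weightU // weight1 cp eqxx.
apply: le_trans (lerD (lexx _) (lerD w1 w2)) _.
have : e%:Z * (#|goods (p |: U1) [set p]| + #|goods (p |: U2) [set p]|)%N%:Z
  <= e%:Z * #|goods Q [set p]|%:Z by rewrite ler_wpM2l.
rewrite PoszD mulrDr PoszM.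
move: (e%:Z * _) (e%:Z * _) (e%:Z * _) => g1 g2 g; clear; lia.
Qed.

Lemma sum_goods (Q A : {set T}) :
  (\sum_(p in A) #|goods Q [set p]| <= 3 * #|goods setT setT|)%N.
Proof.
have E p : #|goods Q [set p]| = (\sum_(t in goods setT setT)
    (t \in goods Q [set p]))%N.
  rewrite -sum1_card [RHS]big_mkcond /= [LHS]big_mkcond /=; apply: eq_bigr => t _.
  case: (boolP (t \in goods Q [set p])) => [|_]; last by case: ifP.
  by move=> /(subsetP (goodsS _ (subsetT _) (subsetT _))) ->.
rewrite (eq_bigr _ (fun p _ => E p)) exchange_big /= mulnC -sum_nat_const.
apply: leq_sum => t; rewrite inE => /and4P[_ /eqP t3 _ _].
rewrite -t3 -sum1_card -big_mkcondr /= [X in (_ <= X)%N]big_mkcond /=.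
rewrite [X in (X <= _)%N]big_mkcond /=; apply: leq_sum => p _.
case: ifP => [/andP[_]|_]; last by [].
rewrite inE => /and4P[_ _ _]; rewrite disjoint_sym disjoints1 negbK => ->.
by [].
Qed.

(** [closed_star] is summed over the points of colour [j]; each triangle is counted at most three
    times. *)
Lemma closed_count j Q : closed Q ->
  #|[set x in Q | chi x == j]|%:Z * (weight j Q - (3 * e)%N%:Z)
    <= (3 * e * #|goods setT setT|)%N%:Z.
Proof.
move=> cQ; set A := [set x in Q | _].
apply: (@le_trans _ _ (\sum_(p in A) (e%:Z * #|goods Q [set p]|%:Z))).
  rewrite -[#|A|%:Z]natz mulr_natl -sumr_const; apply: ler_sum => p; rewrite inE.
  by case/andP=> pQ /eqP cp; rewrite lerBlDr; apply: closed_star.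
rewrite -big_distrr /= mulnAC mulnC PoszM ler_wpM2l //.
by have := sum_goods Q A; rewrite -lez_nat mulnC; rewrite (big_morph _ PoszD erefl).
Qed.

(** * Fan triangulation of a hull *)

Lemma hullset_orient (S : {set T}) u v x : x \in hullset S ->
  exists2 s, s \in S & orient u v x <= orient u v s.
Proof.
rewrite inE => /asboolP/(_ (- (Y v - Y u)) (X v - X u))[s sS le]; exists s => //.
by move: le; rewrite /lin /orient; lra.
Qed.

Lemma ext_orient (S : {set T}) u v x : u != v -> x \in S ->
  (forall s, s \in S -> orient u v s <= orient u v x) -> x \in ext S.
Proof.
move=> uv xS le; rewrite inE xS; apply/asboolP.
exists (- (Y v - Y u)), (X v - X u); split.
  by rewrite orbC subr_eq0 (inj_eq Xinj) eq_sym uv.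
by move=> s /le; rewrite /lin /orient; lra.
Qed.

Section Pivot.
Variables (S : {set T}) (a : T).
Hypothesis aS : a \in S.
Hypothesis amin : forall s, s \in S -> X a <= X s.

Lemma pivot_ext : a \in ext S.
Proof.
rewrite inE aS; apply/asboolP; exists (-1), 0; split; first by rewrite oppr_eq0 oner_eq0.
by move=> s /amin; rewrite /lin; lra.
Qed.

Lemma pivot_lt x : x \in hullset S -> x != a -> X a < X x.
Proof.
rewrite inE => /asboolP/(_ (-1) 0)[s /amin sS le] xa.
by rewrite lt_neqAle (inj_eq Xinj) eq_sym xa; move: le; rewrite /lin; lra.
Qed.

(** All other hull points lie strictly to the right of the leftmost point [a], so slopes order them
    by angle. *)
Lemma pivot_slope x y : x \in hullset S -> y \in hullset S -> x != a -> y != a ->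
  (slope a x < slope a y) = (0 < orient a x y).
Proof.
by move=> xK yK xa ya; rewrite slope_lt // mulr_gt0 // subr_gt0 pivot_lt.
Qed.

Lemma pivot_slope_inj x y : x \in hullset S -> y \in hullset S ->
  x != a -> y != a -> slope a x = slope a y -> x = y.
Proof.
move=> xK yK xa ya E; apply/eqP; apply: contraT => xy.
have h1 := pivot_slope xK yK xa ya; have h2 := pivot_slope yK xK ya xa.
have E' : orient a y x = - orient a x y by rewrite /orient; ring.
rewrite E E' oppr_gt0 !ltxx in h1 h2.
rewrite eq_sym in xa; rewrite eq_sym in ya.
by have := gp xa ya xy; rewrite neq_lt -h1 -h2.
Qed.

(* A hull point beyond the chord [v v'] would force an extreme point beyond it,
   whose direction from [a] is outside of the wedge; then [v] or [v'] would be
   interior to a triangle. *)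
Lemma wedge_inn v v' x : v \in ext S -> v' \in ext S -> v != a -> v' != a ->
  {in ext S, forall u, u != a -> slope a u <= slope a v \/ slope a v' <= slope a u} ->
  x \in hullset S -> x != a -> slope a v < slope a x < slope a v' ->
  x \in inn a v v'.
Proof.
move=> vE v'E va v'a gap xK xa /andP[vx xv'].
have sub u : u \in ext S -> u \in hullset S.
  by move=> uE; exact: (subsetP (sub_hullset S) _ (subsetP (ext_sub S) _ uE)).
have vK := sub _ vE; have v'K := sub _ v'E; have aK := sub _ pivot_ext.
have vv' : slope a v < slope a v' by apply: lt_trans xv'.
have o1 : 0 < orient a v v' by rewrite -pivot_slope.
have o2 : 0 < orient a v x by rewrite -pivot_slope.
have o3 : 0 < orient a x v' by rewrite -pivot_slope.
rewrite inE tri_ccw // o2 (orient_rot v') o3 andbT /=.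
case: (ltP 0 (orient v v' x)) => // o4; exfalso.
have vneqv' : v' != v by apply/eqP => E; rewrite E ltxx in vv'.
have o5 : 0 < orient v' v x.
  rewrite orient_swap oppr_gt0 lt_neqAle o4 andbT.
  apply: gp; rewrite 1?eq_sym //.
    by apply/eqP => E; rewrite E ltxx in vx.
  by apply/eqP => E; rewrite E ltxx in xv'.
have [s0 s0S le0] := hullset_orient v' v xK.
have [y yS ymax] := @arg_maxP _ _ T s0 (mem S) (fun s => orient v' v s) s0S.
have yE : y \in ext S by apply: (ext_orient vneqv').
have yK := sub _ yE.
have oy : 0 < orient v' v y.
  by apply: lt_le_trans o5 (le_trans le0 (ymax _ s0S)).
have ya : y != a.
  apply/eqP => E; move: oy; rewrite E (_ : _ v' v a = - orient a v v').
    by rewrite oppr_gt0 ltNge ltW.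
  by rewrite /orient; ring.
have yv : y != v by apply/eqP => E; rewrite E orientabb ltxx in oy.
have yv' : y != v' by apply/eqP => E; rewrite E orientaba ltxx in oy.
case: (gap _ yE ya) => le.
  have lt : slope a y < slope a v.
    rewrite lt_neqAle le andbT; apply/eqP => E.
    by move/eqP: yv; apply; apply: pivot_slope_inj E.
  have := ext_not_tri vE aK yK v'K; apply/negP; rewrite negbK.
  have o6 : 0 < orient a y v' by rewrite -pivot_slope // (lt_trans lt).
  have E1 : orient y v' v = orient v' v y by rewrite /orient; ring.
  have E2 : orient v' a v = orient a v v' by rewrite /orient; ring.
  by rewrite tri_ccw // -pivot_slope // lt E1 oy E2.
have lt : slope a v' < slope a y.
  rewrite lt_neqAle le andbT; apply/eqP => E.
  by move/eqP: yv'; apply; apply: pivot_slope_inj (esym E).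
have := ext_not_tri v'E aK vK yK; apply/negP; rewrite negbK.
have o6 : 0 < orient a v y by rewrite -pivot_slope // (lt_trans vv').
have E1 : orient v y v' = orient v' v y by rewrite /orient; ring.
have E2 : orient y a v' = orient a v' y by rewrite /orient; ring.
by rewrite tri_ccw // o1 E1 oy E2 -pivot_slope.
Qed.

End Pivot.

(** [a] is the leftmost point of [S], and [v], [v'] are neighbours among the other extreme points in
    the order of slopes at [a]. Pigeonhole selects the sector. The last two clauses split the rest
    of [K] into disjoint parts beyond [a v] and beyond [v' a]. *)
Lemma fan (S K : {set T}) : K \subset hullset S -> (#|ext S| < #|K|)%N ->
  exists a v v', [/\ [/\ a \in ext S, v \in ext S, v' \in ext S
      & 0 < orient a v v'],
    (#|K| <= #|ext S| + #|inn a v v'| * #|ext S|)%N,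
    forall x, x \in K -> x \notin [set a; v; v'] ->
      [\/ x \in inn a v v', orient a v x < 0 | orient v' a x < 0]
    & forall x, x \in K -> orient a v x < 0 -> 0 <= orient v' a x].
Proof.
move=> KS lt; pose K' := K :\: ext S.
have cK : (#|K| <= #|ext S| + #|K'|)%N.
  rewrite -(cardsID (ext S) K) leq_add2r subset_leq_card //; exact: subsetIr.
have K'0 : (0 < #|K'|)%N.
  by move: lt cK; move: #|K| #|K'| #|ext S| => k k' h; clear; lia.
have /card_gt0P[x0 x0K'] := K'0.
have := x0K'; rewrite inE => /andP[x0E x0K].
have KH x : x \in K -> x \in hullset S by move/(subsetP KS).
have [s0 s0S _] := hullset_orient x0 x0 (KH _ x0K).
have [a aS amin] := @arg_minP _ _ T s0 (mem S) X s0S.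
have {}amin s : s \in S -> X a <= X s by exact: amin.
have aE := pivot_ext aS amin.
have sub u : u \in S -> u \in hullset S by move/(subsetP (sub_hullset S)).
have subE u : u \in ext S -> u \in hullset S.
  by move=> uE; apply/sub/(subsetP (ext_sub S)).
have ne x : x \in K' -> x \in K /\ x != a.
  rewrite inE => /andP[xE xK]; split=> //; by apply: contraNneq xE => ->.
have [s xs] : exists s, (s \in S) && (s != a).
  have [_ x0a] := ne _ x0K'.
  have := KH _ x0K; rewrite inE => /asboolP/(_ 1 0)[s sS le].
  exists s; rewrite sS; apply/eqP => E.
  have := pivot_lt amin (KH _ x0K) x0a; rewrite ltNge.
  by move: le; rewrite /lin E !mul1r !mul0r !addr0 => ->.
(* The lowest and the highest direction from [a] belong to extreme points, so all of [K'] lies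
   strictly between them. *)
have [s1 /andP[s1S s1a] s1min] := @arg_minP _ _ T s
  (fun s => (s \in S) && (s != a)) (slope a) xs.
have [s2 /andP[s2S s2a] s2max] := @arg_maxP _ _ T s
  (fun s => (s \in S) && (s != a)) (slope a) xs.
have o1 y : y \in S -> orient s1 a y <= 0.
  move=> yS; have [->|ya] := eqVneq y a; first by rewrite orientabb.
  have := s1min y; rewrite yS ya => /(_ isT).
  rewrite leNgt (pivot_slope amin) ?sub // -leNgt -(orient_rot s1).
  by rewrite -orient_rot.
have o2 y : y \in S -> orient a s2 y <= 0.
  move=> yS; have [->|ya] := eqVneq y a; first by rewrite orientaba.
  have := s2max y; rewrite yS ya => /(_ isT) le; rewrite leNgt.
  by rewrite -(pivot_slope amin) ?sub // -leNgt.
have s1E : s1 \in ext S by apply: (ext_orient s1a) => // y /o1; rewrite orientaba.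
have s2E : s2 \in ext S.
  by apply: (@ext_orient _ a s2) => [||y /o2]; rewrite 1?eq_sym ?orientabb.
have low x : x \in K' -> slope a s1 < slope a x.
  move=> xK'; have [xK xa] := ne _ xK'; rewrite lt_neqAle; apply/andP; split.
    apply/eqP => /(pivot_slope_inj amin (sub _ s1S) (KH _ xK) s1a xa) E.
    by move: xK'; rewrite inE -E s1E.
  rewrite leNgt (pivot_slope amin (KH _ xK) (sub _ s1S) xa s1a) -leNgt.
  have [y /o1 y0 le] := hullset_orient s1 a (KH _ xK).
  by rewrite (orient_rot a) (orient_rot x); apply: le_trans y0.
have high x : x \in K' -> slope a x < slope a s2.
  move=> xK'; have [xK xa] := ne _ xK'; rewrite lt_neqAle; apply/andP; split.
    apply/eqP => /(pivot_slope_inj amin (KH _ xK) (sub _ s2S) xa s2a) E.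
    by move: xK'; rewrite inE E s2E.
  rewrite leNgt (pivot_slope amin (sub _ s2S) (KH _ xK) s2a xa) -leNgt.
  by have [y /o2 y0 le] := hullset_orient a s2 (KH _ xK); apply: le_trans y0.
pose N := ext S :\ a.
(* The last extreme point before [x] in angular order; [s1] always qualifies on [K']. *)
pose lo x := [arg max_(v > s1 | (v \in N) && (slope a v < slope a x)) slope a v]%O.
have loP x : x \in K' -> [/\ lo x \in N, slope a (lo x) < slope a x
    & forall u, u \in N -> slope a u < slope a x -> slope a u <= slope a (lo x)].
  move=> xK'; rewrite /lo; case: arg_maxP => [|v /andP[vN vx] vmax].
    by rewrite in_setD1 s1E s1a low.
  by split=> // u uN ux; apply: vmax; rewrite uN.
have [v vN cv] := pigeonhole_fiber K'0 (fun x xK' => let: And3 h _ _ := loP x xK' in h).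
have [va vE] : v != a /\ v \in ext S by move: vN; rewrite in_setD1 => /andP[].
set F := [set x in K' | lo x == v] in cv.
have [x1 x1F] : exists x, x \in F.
  apply/card_gt0P; rewrite lt0n; apply/eqP => E; move: cv.
  by rewrite E mul0n leqNgt K'0.
have FP x : x \in F -> [/\ x \in K', x \in K, x != a,
    slope a v < slope a x
    & forall u, u \in N -> slope a u < slope a x -> slope a u <= slope a v].
  rewrite inE => /andP[xK' /eqP E]; have [_ h1 h2] := loP _ xK'; rewrite E in h1 h2.
  by have [? ?] := ne _ xK'.
have [x1K' x1K _ vx1 _] := FP _ x1F.
have s2P : (s2 \in N) && (slope a v < slope a s2).
  by rewrite in_setD1 s2E s2a; exact: lt_trans vx1 (high _ x1K').
(* The next extreme point after [v], so that [wedge_inn] applies to the sector between them. *)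
have [v' /andP[v'N vv'] v'min] := @arg_minP _ _ T s2
  (fun u => (u \in N) && (slope a v < slope a u)) (slope a) s2P.
have [v'a v'E] : v' != a /\ v' \in ext S by move: v'N; rewrite in_setD1 => /andP[].
have wedge := wedge_inn aS amin vE v'E va v'a.
have {}wedge x : x \in K -> x != a -> slope a v < slope a x < slope a v' ->
    x \in inn a v v'.
  move=> xK; apply: wedge; last exact: KH.
  move=> u uE ua; case: (leP (slope a u) (slope a v)) => h; [by left|right].
  by apply: v'min; rewrite in_setD1 ua uE h.
have sF : F \subset inn a v v'.
  apply/subsetP => x xF; have [xK' xK xa vx xmax] := FP _ xF.
  apply: wedge => //; rewrite vx /= ltNge le_eqVlt; apply/negP => /orP[/eqP E|h].
    have := pivot_slope_inj amin (subE _ v'E) (KH _ xK) v'a xa E => E'.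
    by move: xK'; rewrite inE -E' v'E.
  by have := xmax _ v'N h; rewrite leNgt vv'.
have H := pivot_slope amin.
exists a, v, v'; split.
- by split=> //; rewrite -H // ?subE.
- apply: leq_trans cK _; rewrite leq_add2l; apply: leq_trans cv _.
  by apply: leq_mul; apply: subset_leq_card => //; apply: subsetDl.
- move=> x xK; rewrite !in_setU !in_set1 !negb_or => /andP[/andP[xa xv] xv'].
  case: (ltgtP (slope a x) (slope a v)) => xv1.
  + constructor 2; have -> : orient a v x = - orient a x v.
      by rewrite /orient; ring.
    by rewrite oppr_lt0 -(H _ _ (KH _ xK) (subE _ vE)).
  + case: (ltgtP (slope a x) (slope a v')) => xv2.
    * by constructor 1; apply: wedge; rewrite // xv1.
    * constructor 3; have -> : orient v' a x = - orient a v' x.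
        by rewrite /orient; ring.
      by rewrite oppr_lt0 -(H _ _ (subE _ v'E) (KH _ xK)).
    * by case/eqP: xv'; apply: (pivot_slope_inj amin (KH _ xK) (subE _ v'E)).
  + by case/eqP: xv; apply: (pivot_slope_inj amin (KH _ xK) (subE _ vE)).
- move=> x xK h; have xa : x != a by apply: contraTneq h => ->; rewrite orientaba ltxx.
  have -> : orient v' a x = orient a x v' by rewrite /orient; ring.
  apply: ltW; rewrite -(H _ _ (KH _ xK) (subE _ v'E)) //; apply: lt_trans vv'.
  rewrite (H _ _ (KH _ xK) (subE _ vE)) //; move: h.
  have -> : orient a v x = - orient a x v by rewrite /orient; ring.
  by rewrite oppr_lt0.
Qed.

(** * Balanced sets and peeling *)

(** Each point counts [e] for its own colour and -1 for each of the [e] others. *)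
Lemma sum_weight (Q : {set T}) : \sum_j weight j Q = 0.
Proof.
rewrite exchange_big /= big1 // => x _; rewrite (bigD1 (chi x)) //= eqxx.
rewrite (eq_bigr (fun _ => -1)) => [|j]; last by rewrite eq_sym => /negPf->.
rewrite sumr_const (_ : #|_| = e); last by rewrite cardC1 card_ord.
by rewrite mulNrn natz subrr.
Qed.

Lemma weightD j (A B : {set T}) : A \subset B ->
  weight j B = weight j A + weight j (B :\: A).
Proof. by move=> /setIidPr E; rewrite /weight (big_setID A) /= E. Qed.

Lemma closedD_lt0 (K : {set T}) u w : closed K ->
  closed (K :\: [set x in K | orient u w x < 0]).
Proof.
move=> cK; rewrite (_ : _ :\: _ = [set x in K | 0 <= orient u w x]).
  exact: closed_ge0.
by apply/setP => x; rewrite in_setD !in_set leNgt; case: (x \in K); rewrite ?andbT ?andbF.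
Qed.

Section Light.
Variables (k N0 : nat).
Hypothesis light : forall Q j, closed Q -> (N0 <= #|Q|)%N -> weight j Q <= k%:Z.

(** The other [e] weights are at most [k] each, and all of them sum to 0. *)
Lemma light_lower Q j : closed Q -> (N0 <= #|Q|)%N ->
  - (e * k)%N%:Z <= weight j Q.
Proof.
move=> cQ NQ; have := sum_weight Q; rewrite (bigD1 j) //= => /eqP.
rewrite addr_eq0 => /eqP->; rewrite lerN2.
apply: (@le_trans _ _ (\sum_(i < e.+1 | i != j) k%:Z)).
  by apply: ler_sum => i _; apply: light.
rewrite sumr_const (_ : #|_| = e); last by rewrite cardC1 card_ord.
by rewrite -mulr_natr natz PoszM mulrC.
Qed.

(** If [A] is too small for [light], its complement in [K] is large, and the bounds for [K] and the
    complement give k + ek. *)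
Lemma light_part j (K A : {set T}) : closed K -> (2 * N0 <= #|K|)%N ->
  A \subset K -> closed A -> closed (K :\: A) -> weight j A <= (e.+1 * k)%N%:Z.
Proof.
move=> cK NK AK cA cKA; case: (leqP N0 #|A|) => NA.
  apply: (le_trans (light j cA NA)); rewrite lez_nat mulSn leq_addr.
by [].
have NKA : (N0 <= #|K :\: A|)%N.
  by rewrite cardsD (setIidPr AK); move: NA NK; move: #|A| #|K| => m n; clear; lia.
have w1 := light j cK (leq_trans (leq_pmull _ _) NK).
have w2 := light_lower j cKA NKA.
have {}w1 := w1 isT; rewrite (weightD j AK) in w1.
move: w1 w2; rewrite mulSn PoszD.
by move: (weight j A) (weight j (K :\: A)) => w1 w2; clear; lia.
Qed.

(** Removing ck + 1 extreme points of colour [j], where c = e + 1, raises the weight of any other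
    colour by that amount, from at least -ek to more than [k]. *)
Lemma ext_bound j (Q K S : {set T}) : closed Q -> S = [set x in Q | chi x == j] ->
  K = Q :&: hullset S -> closed K -> (N0 <= #|K|)%N ->
  (N0 + e.+1 * k < #|K|)%N -> (#|ext S| <= e.+1 * k)%N.
Proof.
move=> cQ ES EK cK NK NK'; rewrite leqNgt; apply/negP => /exists_subset_card[E EE cE].
have EQ : E \subset K.
  apply: (subset_trans EE); apply: (subset_trans (ext_sub S)).
  by rewrite EK subsetI (sub_hullset S) andbT ES; apply/subsetP => x;
    rewrite inE => /andP[].
have cKE : closed (K :\: E) by rewrite EK; apply: (closed_peel).
have [l lj] : exists l : 'I_e.+1, l != j.
  have : (1 < #|'I_e.+1|)%N by rewrite card_ord.
  move/card_gt1P => [x [y [_ _ xy]]]; have [Ex|] := eqVneq x j; last by exists x.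
  by exists y; rewrite -Ex eq_sym.
have wE : weight l E = - (e.+1 * k).+1%:Z.
  rewrite weight_nored ?cE // => x /(subsetP EE) /(subsetP (ext_sub S)).
  by rewrite ES inE => /andP[_ /eqP->]; rewrite eq_sym.
have NKE : (N0 <= #|K :\: E|)%N.
  by rewrite cardsD (setIidPr EQ) cE; move: NK'; move: #|K| (_ * _)%N => m n; clear; lia.
have := light l cKE NKE; have := light_lower l cK NK.
rewrite (weightD l EQ) wE mulSn; move: (weight l _) (e * k)%N => w m; clear; lia.
Qed.

(** [E] consists of the vertices of the fan triangle. [Q'] is the hull part [K] without them, so the
    only points of colour [j] lost are those in [E]. *)
Lemma peel_step j (Q : {set T}) : (0 < k)%N -> (71 * e.+1 ^ 4 * k ^ 3 <= N0)%N ->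
  closed Q -> (2 * N0 < #|[set x in Q | chi x == j]|)%N ->
  exists E Q' : {set T}, [/\ closed Q', Q' \subset Q :\: E,
    E \subset [set x in Q | chi x == j] /\ #|E| = 3%N,
    [set x in Q' | chi x == j] = [set x in Q | chi x == j] :\: E
    & (k <= #|goods Q E|)%N].
Proof.
move=> k0 N0k cQ; set S := [set x in Q | _] => NS.
set K := Q :&: hullset S.
have SK : S \subset K.
  rewrite subsetI (sub_hullset S) andbT; apply/subsetP => x.
  by rewrite inE => /andP[].
have cK : closed K.
  by have := closed_peel (S := S) cQ (sub0set _); rewrite setD0.
have NK : (2 * N0 < #|K|)%N by apply: leq_trans NS (subset_leq_card SK).
have ckN : (e.+1 * k < N0)%N.
  apply: leq_trans N0k; rewrite -mulnA.
  have : (e.+1 * k <= e.+1 ^ 4 * k ^ 3)%N.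
    by rewrite leq_mul // -[X in (X <= _)%N]expn1 leq_pexp2l.
  have : (0 < e.+1 * k)%N by rewrite muln_gt0.
  by move: (e.+1 * k)%N (_ * k ^ 3)%N => x y; clear; lia.
have hb : (#|ext S| <= e.+1 * k)%N.
  apply: (ext_bound cQ erefl erefl cK); move: NK ckN;
    by move: #|K| (e.+1 * k)%N => n m; clear; lia.
have hK : (#|ext S| < #|K|)%N.
  by move: hb NK ckN; move: #|K| (e.+1 * k)%N #|ext S| => n m h; clear; lia.
have [a [v [v' [[aE vE v'E o1] cardK cover A12]]]] :=
  fan (subsetIr Q (hullset S)) hK.
have nab : [/\ a != v, v != v' & a != v'].
  by split; apply/eqP => E; move: o1; rewrite E ?orientaab ?orientaba ?orientabb ltxx.
have [av vv' av'] := nab.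
have ES := subsetP (ext_sub S).
have EK x : x \in ext S -> x \in K by move/ES/(subsetP SK).
have Ec x : x \in ext S -> chi x = j by move/ES; rewrite inE => /andP[_ /eqP].
have iK : inn a v v' \subset K.
  by apply/subsetP => x; rewrite inE => tx; apply: (cK a v v' x _ _ _ tx); apply: EK.
pose A1 := [set x in K | orient a v x < 0].
pose A2 := [set x in K | orient v' a x < 0].
have A1K : A1 \subset K by apply/subsetP => x; rewrite inE => /andP[].
have A2K : A2 \subset K by apply/subsetP => x; rewrite inE => /andP[].
have inA1 x : (x \in A1) = (x \in K) && (orient a v x < 0) by rewrite in_set.
have inA2 x : (x \in A2) = (x \in K) && (orient v' a x < 0) by rewrite in_set.
have w1 : weight j A1 <= (e.+1 * k)%N%:Z.
  by apply: (light_part _ cK (ltnW NK) A1K); [apply: closed_lt0|apply: closedD_lt0].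
have w2 : weight j A2 <= (e.+1 * k)%N%:Z.
  by apply: (light_part _ cK (ltnW NK) A2K); [apply: closed_lt0|apply: closedD_lt0].
have A2K1 : A2 \subset K :\: A1.
  apply/subsetP => x; rewrite in_setD inA1 inA2 => /andP[xK x2]; rewrite xK andbT /=.
  by apply: contraL x2 => /(A12 _ xK); rewrite -leNgt.
have EKA : K :\: A1 :\: A2 = [set a; v; v'] :|: inn a v v'.
  apply/setP => x; rewrite in_setD in_setU; apply/idP/idP.
    rewrite in_setD; case/and3P=> x2 x1 xK; case: (boolP (x \in [set a; v; v'])) => //= xn.
    by case: (cover _ xK xn) => // o; [move: x1; rewrite inA1|move: x2; rewrite inA2]; rewrite xK o.
  case/orP=> xi.
    have xK : x \in K.
      by move: xi; rewrite !in_setU !in_set1 => /orP[/orP[]|] /eqP->; apply: EK.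
    rewrite !in_setD inA1 inA2 xK /= andbT -!leNgt.
    move: xi; rewrite !in_setU !in_set1 => /orP[/orP[]|] /eqP->;
    rewrite ?orientaab ?orientaba ?orientabb ?lexx ?(ltW o1) //.
    by rewrite (orient_rot v') ltW.
  rewrite !in_setD inA1 inA2 (subsetP iK _ xi) /= andbT -!leNgt.
  by move: xi; rewrite inE tri_ccw // => /and3P[/ltW-> _ /ltW->].
have wK := light_lower j cK (leq_trans (leq_pmull _ (isT : (0 < 2)%N)) (ltnW NK)).
rewrite (weightD j A1K) (weightD j A2K1) EKA weightU in wK; last first.
  apply/pred0P => x /=; apply/negP => /andP[x3]; rewrite inE => /tri_neq[_ _ _ [x1 x2]].
  by move: x3; rewrite !inE (negPf x1) (negPf x2) => /eqP->; rewrite eqxx.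
have w3 : weight j [set a; v; v'] = (3 * e)%N%:Z.
  rewrite weight_card (_ : [set x in _ | _] = [set a; v; v']); last first.
    apply/setP => x; rewrite !inE; case: eqP => [->|_]; first by rewrite Ec // eqxx.
    case: eqP => [->|_]; first by rewrite Ec // eqxx.
    by case: eqP => [->|_] //; rewrite Ec // eqxx.
  by rewrite card3 //; clear; lia.
set W := weight j (inn a v v') in wK.
(* With c = e + 1: [K] weighs at least -ek, the two outer parts at most ck each, and the vertices
   3e. *)
have wI : - (6 * e.+1 * k)%N%:Z <= W.
  have kk : (3 * e <= 3 * e.+1 * k)%N.
    by rewrite -mulnA leq_mul // (leq_trans (leqnSn e)) // leq_pmulr.
  rewrite -!mulnA in kk *; move: wK w1 w2 kk; rewrite w3 !(mulSn e).
  move: (weight _ _) (weight _ _) W (e * k)%N => p q r m; clear; lia.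
have many := fan_triangle_size (ltn0Sn e) k0 hb cardK N0k NK.
(* By [wI], c times the number of coloured points inside is at least the number of all points inside
   minus 6ck. *)
have r2 : (8 * e.+1 * k * (8 * e.+1 * k) < #|[set x in inn a v v' | chi x == j]|)%N.
  rewrite -(ltn_pmul2l (ltn0Sn e)); move: wI; rewrite /W weight_card.
  move: many; move: (e.+1 * (8 * _ * _ * _))%N (6 * _ * _)%N (e.+1 * #|_|)%N #|_|.
  by move=> p q r m; clear; lia.
have := long_chain av vv' av' (Ec _ aE) (Ec _ vE) (Ec _ v'E) r2.
rewrite -/W => G; exists [set a; v; v'], (K :\: [set a; v; v']); split.
- apply: (closed_peel cQ); apply/subsetP => x.
  by rewrite !in_setU !in_set1 => /orP[/orP[]|] /eqP->.
- by apply: setSD; apply: subsetIl.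
- split; last exact: card3.
  apply/subsetP => x; rewrite !in_setU !in_set1.
  by case/orP=> [/orP[]|] /eqP->; apply: ES.
- apply/setP => x; rewrite in_set !in_setD -andbA; congr (_ && _).
  apply/andP/idP => [[xK cx]|xS]; first by rewrite inE cx andbT; case/setIP: xK.
  by rewrite (subsetP SK _ xS); move: xS; rewrite inE => /andP[].
- have clQ : cl a v v' \subset Q.
    apply: subset_trans (subsetIl Q (hullset S)); rewrite subUset iK andbT.
    apply/subsetP => x; rewrite !in_setU !in_set1.
    by case/orP=> [/orP[]|] /eqP->; apply: EK.
  apply: leq_trans (subset_leq_card (goodsS good clQ (subxx _))).
  move: G wI; set g := #|_|; rewrite -!mulnA; set m := (e.+1 * k)%N => G wI.
  have km : (k <= m)%N by rewrite leq_pmull.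
  (* The chain supplies 8ck + 2 triangles and the negative weight costs at most 6ck, which leaves
     more than [k]. *)
  have : (e * (8 * m).+2 <= e * (g + 6 * m))%N.
    rewrite mulnDr; apply: (@leq_trans (e * g + 6 * m)).
      by move: G wI; rewrite -!PoszM; move: (W) (e * g)%N (e * _)%N (6 * m)%N;
        clear; lia.
    by rewrite leq_add2l leq_pmull.
  by rewrite leq_pmul2l //; move: km; move: (m) (g) (k); clear; lia.
Qed.

(** Each step spends three points of the colour and gains [k] triangles that meet [E]; later ones
    avoid [E], so nothing is counted twice. *)
Lemma peel j (Q : {set T}) : (0 < k)%N -> (71 * e.+1 ^ 4 * k ^ 3 <= N0)%N ->
  closed Q -> (k * (#|[set x in Q | chi x == j]| - 2 * N0) <= 3 * #|goods Q setT|)%N.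
Proof.
move=> k0 N0k; have [n] := ubnP #|[set x in Q | chi x == j]|.
elim: n Q => // n IH Q; rewrite ltnS => le cQ.
case: (leqP #|[set x in Q | chi x == j]| (2 * N0)) => [|lt].
  by rewrite -subn_eq0 => /eqP->; rewrite muln0.
have [E [Q' [cQ' sQ' [ES E3] red kE]]] := peel_step k0 N0k cQ lt.
have dj : [disjoint goods Q E & goods Q' setT].
  apply/pred0P => t /=; apply/negP; rewrite !inE.
  case/andP=> /and4P[_ _ _ /pred0Pn[x /andP[xt xE]]] /and4P[_ _ /subsetP tQ' _].
  have {}xE : x \in E := xE.
  by have := subsetP sQ' _ (tQ' _ xt); rewrite inE xE.
have gl : (#|goods Q E| + #|goods Q' setT| <= #|goods Q setT|)%N.
  move: dj; rewrite -leq_card_setU => /eqP<-; apply: subset_leq_card.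
  rewrite subUset !goodsS ?subsetT // (subset_trans sQ') //; exact: subsetDl.
set S := [set x in Q | _] in le lt red *.
have cS : #|S| = (#|S :\: E| + 3)%N.
  by rewrite -(cardsID E S) (setIidPr ES) E3 addnC.
have lt' : (#|S :\: E| < n)%N by rewrite -addn1; apply: leq_trans le; rewrite cS leq_add2l.
have := IH Q'; rewrite red => /(_ lt' cQ') h.
apply: (@leq_trans (k * (#|S :\: E| - 2 * N0 + 3))).
  by rewrite leq_mul2l; apply/orP; right; rewrite cS; move: #|_|; clear; lia.
rewrite mulnDr; move: h gl kE; move: #|_| #|_| #|_| (k * _)%N; clear; lia.
Qed.
End Light.

(** Either every large closed set is light, and peeling the most frequent colour gives the bound, or
    [closed_count] applies to a heavy one. *)
Lemma good_count k N0 : (4 * e.+1 <= k)%N -> (71 * e.+1 ^ 4 * k ^ 3 <= N0)%N ->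
  (4 * e.+1 * N0 <= #|T|)%N ->
  (N0 * k <= 12 * e.+1 ^ 2 * #|goods setT setT|)%N.
Proof.
move=> ck N0k NT; have k0 : (0 < k)%N by apply: leq_trans ck.
have [light|/existsNP[Q /existsNP[j]]] := pselect (forall (Q : {set T}) j,
    closed Q -> (N0 <= #|Q|)%N -> weight j Q <= k%:Z).
  have [j cj] : exists j, (4 * N0 <= #|[set x in setT | chi x == j]|)%N.
    have [j _ jmax] := @arg_maxnP _ (ord0 : 'I_e.+1) xpredT
      (fun j => #|[set x in setT | chi x == j]|) isT.
    exists j; rewrite -(leq_pmul2l (ltn0Sn e)) mulnCA mulnA; apply: leq_trans NT _.
    rewrite -cardsT -sum1_card (partition_big chi xpredT) //=.
    apply: (@leq_trans (\sum_(i < e.+1) #|[set x in setT | chi x == j]|)).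
      2: by rewrite sum_nat_const card_ord.
    apply: leq_sum => i _.
    apply: leq_trans (jmax i isT); rewrite -sum1_card leq_eqVlt; apply/orP; left.
    by apply/eqP; apply: eq_bigl => x; rewrite !inE.
  have cT : closed setT by move=> *; rewrite inE.
  have h := peel light j k0 N0k cT.
  apply: (@leq_trans (3 * #|goods setT setT|)); last first.
    by rewrite leq_mul2r; apply/orP; right; rewrite -[X in (X <= _)%N]muln1 leq_mul // expn_gt0.
  apply: leq_trans h; rewrite mulnC leq_mul2l; apply/orP; right.
  by move: cj; move: #|_|; clear; lia.
move=> /not_implyP[cQ /not_implyP[NQ /negP]]; rewrite -ltNge => w.
have := closed_count j cQ.
have := weight_card j Q; set r := #|[set x in Q | _]|; set g := #|goods _ _|.
move: (weight j Q) w => w kw Ew h.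
have Nr : (N0 <= e.+1 * r)%N.
  apply: (leq_trans NQ); move: kw; rewrite Ew; move: (_ * r)%N #|Q| (k); clear; lia.
(* Since the weight exceeds [k] and [k] is at least 4(e + 1), subtracting 3e leaves at least k/4. *)
have h1 : r%:Z * k%:Z <= 4 * (3 * e * g)%N%:Z.
  apply: le_trans (_ : r%:Z * (4 * (w - (3 * e)%N%:Z)) <= _); last first.
    by rewrite mulrCA ler_wpM2l.
  by rewrite ler_wpM2l //; move: ck kw; clear; lia.
have h2 : (r * k <= 12 * (e * g))%N.
  move: h1; rewrite -PoszM -(PoszM 4) lez_nat; move=> /leq_trans; apply.
  by rewrite -mulnA mulnA.
apply: (@leq_trans (e.+1 * r * k)); first by rewrite leq_mul2r Nr orbT.
rewrite -mulnA; apply: (@leq_trans (e.+1 * (12 * (e * g)))).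
  by rewrite leq_mul2l h2 orbT.
rewrite (_ : 12 * e.+1 ^ 2 * g = e.+1 * (12 * (e.+1 * g)))%N; last by ring.
by rewrite !leq_mul2l leq_mul2r leqnSn !orbT.
Qed.

End PlanarSets.

(** * Point sets in the plane *)

From mathcomp Require Import finmap classical_sets topology normedtype.
Import numFieldNormedType.Exports.

Section PlaneSets.
Variable R : realType.
Local Notation plane := ('rV[R]_2).

Lemma interior_ray (A : set plane) x v : (A°)%classic x ->
  exists2 t : R, 0 < t & A (x + t *: v).
Proof.
move=> /nbhs_normP[r /= r0 xr].
have v1 : 0 < `|v| + 1 by rewrite ltr_wpDl.
exists (r / (`|v| + 1)); first by rewrite divr_gt0.
apply: xr; rewrite /= opprD addrA subrr sub0r normrN normrZ.
rewrite ger0_norm; last by rewrite divr_ge0 // ltW.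
by rewrite mulrAC ltr_pdivrMr // ltr_pM2l // ltrDl.
Qed.

Lemma sum_set3 (V : nmodType) (T : finType) (a b d : T) (F : T -> V) :
  a != b -> b != d -> a != d ->
  \sum_(i in [set a; b; d]%SET) F i = F a + F b + F d.
Proof.
move=> ab bd ad; rewrite finset.setUC big_setU1 /=; last first.
  by rewrite !inE negb_or eq_sym ad eq_sym bd.
by rewrite big_setU1 ?big_set1 ?inE //= addrC.
Qed.

Lemma orient_ray (t u w a0 a1 b0 b1 d0 d1 x0 x1 : R) :
  x0 + t * (x0 - d0) = (1 - u - w) * a0 + u * b0 + w * d0 ->
  x1 + t * (x1 - d1) = (1 - u - w) * a1 + u * b1 + w * d1 ->
  (1 + t) * ((b0 - a0) * (x1 - a1) - (x0 - a0) * (b1 - a1)) =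
  (w + t) * ((b0 - a0) * (d1 - a1) - (d0 - a0) * (b1 - a1)).
Proof.
move=> E0 E1.
have F0 : (1 + t) * x0 = (1 - u - w) * a0 + u * b0 + w * d0 + t * d0.
  by rewrite -E0; ring.
have F1 : (1 + t) * x1 = (1 - u - w) * a1 + u * b1 + w * d1 + t * d1.
  by rewrite -E1; ring.
transitivity ((b0 - a0) * ((1 + t) * x1 - (1 + t) * a1)
  - ((1 + t) * x0 - (1 + t) * a0) * (b1 - a1)); first by ring.
by rewrite F0 F1; ring.
Qed.

Section Coordinates.
Variables (P : {fset plane}) (la : R).

(* A shear makes the first coordinate injective on [P] without changing
   orientations. *)
Let X (p : P) := val p 0 0 + la * val p 0 1.
Let Y (p : P) := val p 0 1.

Lemma shear_orient (a b d : P) : orient X Y a b d =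
  orient (fun p : P => val p 0 0) Y a b d.
Proof. by rewrite /orient /X /Y; ring. Qed.

Lemma shear_gp : general_position P ->
  forall a b d, a != b -> a != d -> b != d -> orient X Y a b d != 0.
Proof.
move=> gP a b d ab ad bd; apply/eqP; rewrite shear_orient => o0.
apply: (gP _ _ _ (valP a) (valP b) (valP d)); rewrite ?(inj_eq val_inj) //.
have v0 : val b - val a != 0 by rewrite subr_eq0 (inj_eq val_inj) eq_sym.
exists [set val a + t *: (val b - val a) | t in [set: R]]%classic; split.
- by exists (val a), (val b - val a).
- by exists 0 => //; rewrite scale0r addr0.
- by exists 1 => //; rewrite scale1r addrC subrK.
(* The line parameter of [d] is solved from the first coordinate, or from the second if the line is
   vertical. *)
have [e0|n0] := eqVneq (val b 0 0 - val a 0 0) 0; last first.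
  exists ((val d 0 0 - val a 0 0) / (val b 0 0 - val a 0 0)) => //.
  apply/rowP => i; rewrite !mxE; move: o0; rewrite /orient /Y.
  case: i => [[|[|//]] i] /=.
    rewrite (_ : Ordinal i = 0); last exact: val_inj.
    by move=> _; field.
  rewrite (_ : Ordinal i = 1); last exact: val_inj.
  move=> /subr0_eq E; rewrite mulrAC -E mulrAC divff // mul1r.
  by rewrite addrC subrK.
have n1 : val b 0 1 - val a 0 1 != 0.
  apply: contra v0 => /eqP e1; apply/eqP/rowP => i; rewrite !mxE.
  case: i => [[|[|//]] i] /=; first by rewrite (_ : Ordinal i = 0) //; apply: val_inj.
  by rewrite (_ : Ordinal i = 1) //; apply: val_inj.
exists ((val d 0 1 - val a 0 1) / (val b 0 1 - val a 0 1)) => //.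
apply/rowP => i; rewrite !mxE; move: o0; rewrite /orient /Y e0 mul0r sub0r.
move/eqP; rewrite oppr_eq0 mulf_eq0 (negPf n1) orbF subr_eq0 => /eqP da.
case: i => [[|[|//]] i] /=.
  rewrite (_ : Ordinal i = 0); last exact: val_inj.
  by rewrite e0 mulr0 addr0 da.
rewrite (_ : Ordinal i = 1); last exact: val_inj.
by field.
Qed.

(** An interior point can be pushed slightly away from [d] within the hull. The coefficient of [d]
    is still nonnegative there, so it was positive at [x]. *)
Lemma hull_side (a b d x : P) : a != b -> b != d -> a != d ->
  orient X Y a b d != 0 -> x \in interior_points [set a; b; d]%SET ->
  0 < orient X Y a b d * orient X Y a b x.
Proof.
move=> ab bd ad o0; rewrite inE => /asboolP xi.
have [t t0 [w [w0 w1 E]]] := interior_ray (val x - val d) xi.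
rewrite !sum_set3 // in w1 E.
have wd : 0 <= w d by apply: w0; rewrite !inE eqxx !orbT.
have E' i := congr1 (fun p : plane => p 0 i) E.
have E0 := E' 0; have {E' E}E1 := E' 1; rewrite !mxE in E0 E1.
have key : (1 + t) * orient X Y a b x = (w d + t) * orient X Y a b d.
  have wa : w a = 1 - w b - w d by rewrite -w1; ring.
  rewrite wa in E0 E1; rewrite (shear_orient a b x) (shear_orient a b d).
  exact: (orient_ray E0 E1).
have : 0 < (1 + t) * (orient X Y a b d * orient X Y a b x).
  by rewrite mulrCA key mulrCA mulr_gt0 ?ltr_wpDl // -expr2 exprn_even_gt0.
by rewrite pmulr_rgt0 // addr_gt0.
Qed.

Lemma interior_tri (a b d x : P) : a != b -> b != d -> a != d ->
  orient X Y a b d != 0 -> x \in interior_points [set a; b; d]%SET ->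
  tri X Y a b d x.
Proof.
move=> ab bd ad o0 xi.
have da : d != a by rewrite eq_sym.
have ba : b != a by rewrite eq_sym.
have db : d != b by rewrite eq_sym.
have E1 := orient_rot X Y a b d; have E2 := orient_rot X Y d a b.
have S1 : [set a; b; d]%SET = [set b; d; a]%SET.
  by apply/setP => y; rewrite !inE; case: (y == a); case: (y == b); case: (y == d).
have S2 : [set a; b; d]%SET = [set d; a; b]%SET.
  by apply/setP => y; rewrite !inE; case: (y == a); case: (y == b); case: (y == d).
apply/and3P; split; first exact: hull_side.
  have o1 := o0; rewrite E1 in o1 *; have xi1 := xi; rewrite S1 in xi1.
  exact: hull_side.
have o2 := o0; rewrite -E2 in o2 *; have xi2 := xi; rewrite S2 in xi2.
exact: hull_side.
Qed.
End Coordinates.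

(** Points with different second coordinates collide for the single value [r] only, and [la] exceeds
    all of these. Equal second coordinates give [r] the value 0 of division by zero and are treated
    separately. *)
Lemma shear_inj (P : {fset plane}) :
  exists la : R, injective (fun p : P => val p 0 0 + la * val p 0 1).
Proof.
pose r (u : P * P) := (val u.2 0 0 - val u.1 0 0) / (val u.1 0 1 - val u.2 0 1).
exists (1 + \sum_u `|r u|) => p q E; apply/eqP; apply: contraT => pq.
set la := 1 + _ in E.
have lt : r (p, q) < la.
  rewrite /la (bigD1 (p, q)) //= addrCA (le_lt_trans (ler_norm _)) // ltrDl.
  by rewrite ltr_pwDl // sumr_ge0.
have E1 : la * (val p 0 1 - val q 0 1) = val q 0 0 - val p 0 0.
  by move: E => /= E; lra.
have [e0|n0] := eqVneq (val p 0 1 - val q 0 1) 0.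
  case/eqP: pq; apply/val_inj/rowP => i.
  rewrite e0 mulr0 in E1.
  case: i => [[|[|//]] i] /=.
    by rewrite (_ : Ordinal i = 0) ?[LHS]E1; [lra|apply: val_inj].
  by rewrite (_ : Ordinal i = 1); [lra|apply: val_inj].
by move: lt; rewrite /r /= -E1 mulfK // ltxx.
Qed.

End PlaneSets.

(** * Transfer to coloured point sets and choice of constants *)

Lemma X_le_count (R : realType) (e k N0 : nat) (P : {fset 'rV[R]_2})
    (chi : P -> 'I_e.+1) : (0 < e)%N -> general_position P ->
  (4 * e.+1 <= k)%N -> (71 * e.+1 ^ 4 * k ^ 3 <= N0)%N ->
  (4 * e.+1 * N0 <= #|` P|)%N ->
  (N0 * k <= 12 * e.+1 ^ 2 * X_le (e.+1 - 2) chi)%N.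
Proof.
move=> e0 gP ck N0k NP; have [la inj] := shear_inj P.
have gp := shear_gp la gP.
pose good : pred {set P} := fun t => [&& #|t| == 3%N, monochromatic chi t
  & (#|interior_points t| <= e.+1 - 2)%N].
rewrite cardfE in NP.
apply: leq_trans (good_count (good := good) gp inj e0 _ ck N0k NP) _.
  move=> a b d ab bd ad cab cbd lt; rewrite /good card3 //=; apply/andP; split.
    have col z : z \in [set a; b; d]%SET -> chi z = chi d.
      rewrite !inE => /orP[/orP[]|] /eqP->; [exact: (etrans cab cbd)|exact: cbd|by []].
    by apply/forall_inP => x /col ->; apply/forall_inP => y /col ->.
  (* With e + 1 colours the bound [s] is e - 1. Topological interior points lie in [inn], so fewer
     than [e] points there suffice. *)
  apply: (@leq_trans e.-1); last by lia.
  rewrite -ltnS prednK //; apply: leq_ltn_trans lt; apply: subset_leq_card.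
  apply/fintype.subsetP => x xi; rewrite inE; apply: interior_tri => //.
  by apply: gp.
rewrite leq_mul2l; apply/orP; right; apply: subset_leq_card.
by apply/fintype.subsetP => t; rewrite !inE => /and4P[].
Qed.

Theorem theorem2 (R : realType) (c : nat) (hc : (2 <= c)%N) :
  exists L : R, 0 < L /\
    exists n0 : nat, forall n : nat, (n0 <= n)%N ->
      L * n%:R `^ (4 / 3) <= (X_min R c (c - 2) n)%:R.
Proof.
case: c hc => // e; rewrite ltnS => e0.
set c := e.+1; have c0 : (0 < c)%N by [].
(* 284 c^5 is 4c times 71 c^4, so that [C * k ^ 3 <= n] gives the size required of [N0]. *)
have [C [EC C0]] : exists C, C = (284 * c ^ 5)%N /\ (0 < C)%N.
  by exists (284 * c ^ 5)%N; rewrite muln_gt0 expn_gt0.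
have D0 : (0 < 192 * c ^ 3 * C)%N by rewrite muln_gt0 C0 muln_gt0 expn_gt0.
(* The factor 96 c^3 comes from [nkG] and 2C from [root]. *)
exists ((192 * c ^ 3 * C)%N%:R^-1); split.
  by rewrite invr_gt0 ltr0n.
(* This threshold forces the cube root [k] to be at least 4c. *)
exists (C * (4 * c) ^ 3)%N => n len.
have [[P [chi [gP cP Xm]]] _] := X_minP R (c - 2) n c0.
have [k /andP[kn nk]] := cube_root_nat n C0.
have ck : (4 * c <= k)%N.
  rewrite -ltnS -(ltn_exp2r _ _ (isT : (0 < 3)%N)) -(ltn_pmul2l C0).
  exact: leq_ltn_trans len nk.
have k0 : (0 < k)%N by apply: leq_trans ck.
pose N0 := (n %/ (4 * c))%N.
have N0k : (71 * c ^ 4 * k ^ 3 <= N0)%N.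
  rewrite leq_divRL ?muln_gt0 //; apply: leq_trans kn; rewrite EC leq_eqVlt.
  by apply/orP; left; apply/eqP; ring.
have N0n : (4 * c * N0 <= #|` P|)%N by rewrite cP mulnC leq_trunc_div.
have := X_le_count chi e0 gP ck N0k N0n; rewrite Xm; set G := X_min _ _ _ _ => h.
have nN0 : (n <= 8 * c * N0)%N.
  have N1 : (0 < N0)%N.
    by apply: leq_trans N0k; rewrite muln_gt0 expn_gt0 k0 andbT muln_gt0 expn_gt0.
  apply: ltnW; apply: leq_trans (ltn_ceil n (_ : 0 < 4 * c)%N) _ => //.
  rewrite -/N0 mulnC (_ : 8 * c * N0 = 4 * c * (2 * N0))%N; last by ring.
  by rewrite leq_mul2l -[N0.+1]addn1 mul2n -addnn leq_add2l N1 orbT.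
have nkG : (n * k <= 96 * c ^ 3 * G)%N.
  apply: leq_trans (leq_mul nN0 (leqnn k)) _; rewrite -mulnA.
  rewrite (_ : 96 * c ^ 3 * G = 8 * c * (12 * c ^ 2 * G))%N; last by ring.
  by rewrite leq_mul2l h orbT.
have nC : (n <= (2 * C * k) ^ 3)%N.
  apply: (leq_trans (ltnW nk)); apply: (@leq_trans (C * (2 * k) ^ 3)).
    by rewrite leq_mul2l leq_exp2r // -[k.+1]addn1 mul2n -addnn leq_add2l k0 orbT.
  rewrite (_ : 2 * C * k = C * (2 * k))%N; last by ring.
  rewrite (expnMn C); apply: leq_mul => //.
  by rewrite -[X in (X <= _)%N]expn1 leq_pexp2l.
have n0 : (0 < n)%N by apply: leq_trans len; rewrite muln_gt0 C0 expn_gt0.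
have root : (n%:R : R) `^ (1 / 3) <= (2 * C * k)%N%:R.
  apply: (@le_trans _ _ (((2 * C * k) ^ 3)%N%:R `^ (1 / 3))).
    by rewrite ge0_ler_powR ?nnegrE ?ler_nat ?divr_ge0.
  rewrite natrX -powR_mulrn // -powRrM (_ : 3%:R * (1 / 3) = 1); last by field.
  by rewrite powRr1.
have -> : n%:R `^ (4 / 3) = n%:R * n%:R `^ (1 / 3) :> R.
  rewrite -{2}[n%:R]powRr1 // -powRD; last by rewrite pnatr_eq0 -lt0n n0 implybT.
  by congr (_ `^ _); field.
rewrite mulrC ler_pdivrMr ?ltr0n //.
apply: le_trans (ler_wpM2l (ler0n _ _) root) _.
rewrite -!natrM ler_nat (_ : n * (2 * C * k) = 2 * C * (n * k))%N; last by ring.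
rewrite (_ : G * (192 * c ^ 3 * C) = 2 * C * (96 * c ^ 3 * G))%N; last by ring.
by rewrite leq_mul2l nkG orbT.
Qed.
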